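(* Let $\mathbb F$ be an algebraically closed field of characteristic different from $2$. (a) Every pair $(A,B)$ of symmetric matrices over $\mathbb F$ of the same size is congruent to a direct sum, determined uniquely up to permutation of summands, of pairs of symmetric tridiagonal $n\times n$ matrices ($n$ a positive integer) of the following two types. Here the ''off-diagonal sequence'' of a symmetric tridiagonal matrix $X$ means the sequence of its entries $X_{j,j+1}=X_{j+1,j}$, $j=1,\dots,n-1$. (i) The pair whose first matrix has zero diagonal and off-diagonal sequence $1,0,1,0,\dots$, and whose second matrix has diagonal $(\varepsilon,0,\dots,0)$ and off-diagonal sequence $\lambda,1,\lambda,1,\dots$, where $\lambda\in\mathbb F$, $\varepsilon\in\{0,1\}$, $\varepsilon=1$ if $n$ is even, and $\lambda=0$ if $n$ is odd. (ii) The pair whose first matrix has diagonal $(1,0,\dots,0)$ and off-diagonal sequence $0,1,0,1,\dots$, and whose second matrix has diagonal $(\lambda,0,\dots,0)$ and off-diagonal sequence $1,\lambda,1,\lambda,\dots$, where $\lambda=0$ if $n$ is even and $\lambda\in\mathbb F$ if $n$ is odd. (b) This direct sum is determined uniquely up to permutation of summands by the Kronecker canonical form of $(A,B)$ under equivalence. The Kronecker canonical form of each of the direct summands is as follows: - type (i): $(F_k,G_k)\oplus(F_k^T,G_k^T)$ if $n=2k+1$ and $\varepsilon=0$; $(J_n(0),I_n)$ if $n$ is odd and $\varepsilon=1$; $(I_n,J_n(\lambda))$ if $n$ is even; - type (ii): $(I_n,J_n(\lambda))$ if $n$ is odd; $(J_n(0),I_n)$ if $n$ is even.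
   Context: Matrix pairs $(A,B)$ and $(A',B')$ of square matrices are congruent if there is a nonsingular $S$ with $S^TAS=A'$ and $S^TBS=B'$. Matrix pairs $(A,B)$ and $(A',B')$ are equivalent if there are nonsingular $R,S$ with $RAS=A'$ and $RBS=B'$. Direct sums of pairs are taken componentwise: $(A,B)\oplus(A',B')=(A\oplus A',B\oplus B')$. $I_n$ is the $n\times n$ identity matrix and $J_n(\lambda)$ is the $n\times n$ upper triangular Jordan block with eigenvalue $\lambda$ (ones on the superdiagonal). For $n\ge 0$, $F_n$ and $G_n$ are the $n\times(n+1)$ matrices $F_n=[\,I_n\ |\ 0\,]$ (identity followed by a zero column) and $G_n=[\,0\ |\ I_n\,]$ (zero column followed by the identity); $F_0=G_0$ is the $0\times 1$ matrix (taking a direct sum with it adjoins a zero column; with its transpose, a zero row). Kronecker's theorem: each pair of matrices of the same size is equivalent to a direct sum, determined uniquely up to permutation of summands, of pairs of the form $(I_n,J_n(\lambda))$, $(J_n(0),I_n)$, $(F_n,G_n)$, $(F_n^T,G_n^T)$; this direct sum is the Kronecker canonical form of the pair. *)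

(* Defs.v *)
From HB Require Import structures.
From mathcomp Require Import all_boot all_order all_algebra.
Set Implicit Arguments.
Unset Strict Implicit.
Unset Printing Implicit Defensive.
Import GRing.Theory.
Local Open Scope ring_scope.

(* Pairs (A, B) are passed as two matrix arguments of the same size. *)

Definition congruent (F : fieldType) (n : nat) (A B A' B' : 'M[F]_n) : Prop :=
  exists2 S : 'M[F]_n, S \in unitmx &
    S^T *m A *m S = A' /\ S^T *m B *m S = B'.

Definition equivalent (F : fieldType) (m n : nat) (A B A' B' : 'M[F]_(m, n))
    : Prop :=
  exists (R : 'M[F]_m) (S : 'M[F]_n),
    [/\ R \in unitmx, S \in unitmx, R *m A *m S = A' & R *m B *m S = B'].

(* Direct sum of the matrices M x, for x ranging over a sequence of labels.
   The summands may have no rows or no columns: a 0 x 1 summand adjoins a zero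
   column. *)
Fixpoint dsum (F : fieldType) (L : Type) (r c : L -> nat)
    (M : forall x : L, 'M[F]_(r x, c x)) (s : seq L)
    : 'M[F]_(sumn (map r s), sumn (map c s)) :=
  match s return 'M[F]_(sumn (map r s), sumn (map c s)) with
  | [::] => 0
  | x :: s' => block_mx (M x) 0 0 (dsum M s')
  end.

Definition Jordan (F : fieldType) (n : nat) (lambda : F) : 'M[F]_n :=
  \matrix_(i < n, j < n)
    (if j == i then lambda else if j == i.+1 :> nat then 1 else 0).

(* [ I_n | 0 ] and [ 0 | I_n ] *)
Definition Fmx (F : fieldType) (n : nat) : 'M[F]_(n, n.+1) :=
  \matrix_(i < n, j < n.+1) (j == i :> nat)%:R.
Definition Gmx (F : fieldType) (n : nat) : 'M[F]_(n, n.+1) :=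
  \matrix_(i < n, j < n.+1) (j == i.+1 :> nat)%:R.

(* Labels of the Kronecker blocks:
     KJ n lambda  for  (I_n, J_n(lambda)),    Kinf n  for  (J_n(0), I_n),
     KF n         for  (F_n, G_n),            KFT n   for  (F_n^T, G_n^T). *)
Inductive kblock (F : Type) : Type :=
  | KJ of nat & F
  | Kinf of nat
  | KF of nat
  | KFT of nat.
Arguments Kinf {F} n.
Arguments KF {F} n.
Arguments KFT {F} n.

Definition kblock_code (F : Type) (b : kblock F) : nat * F + nat + nat + nat :=
  match b with
  | KJ n l => inl (inl (inl (n, l)))
  | Kinf n => inl (inl (inr n))
  | KF n => inl (inr n)
  | KFT n => inr n
  end.
Definition kblock_decode (F : Type) (x : nat * F + nat + nat + nat) : kblock F :=
  match x with
  | inl (inl (inl nl)) => KJ nl.1 nl.2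
  | inl (inl (inr n)) => Kinf n
  | inl (inr n) => KF n
  | inr n => KFT n
  end.
Lemma kblock_codeK (F : Type) : cancel (@kblock_code F) (@kblock_decode F).
Proof. by case. Qed.
HB.instance Definition _ (F : eqType) :=
  Equality.copy (kblock F) (can_type (@kblock_codeK F)).

Definition kblock_ok (F : Type) (b : kblock F) : bool :=
  match b with
  | KJ n _ | Kinf n => (0 < n)%N
  | KF _ | KFT _ => true
  end.

Definition krows (F : Type) (b : kblock F) : nat :=
  match b with KJ n _ | Kinf n | KF n => n | KFT n => n.+1 end.
Definition kcols (F : Type) (b : kblock F) : nat :=
  match b with KJ n _ | Kinf n | KFT n => n | KF n => n.+1 end.

Definition kfst (F : fieldType) (b : kblock F) : 'M[F]_(krows b, kcols b) :=
  match b return 'M[F]_(krows b, kcols b) with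
  | KJ n _ => 1%:M
  | Kinf n => Jordan n 0
  | KF n => Fmx F n
  | KFT n => (Fmx F n)^T
  end.
Definition ksnd (F : fieldType) (b : kblock F) : 'M[F]_(krows b, kcols b) :=
  match b return 'M[F]_(krows b, kcols b) with
  | KJ n l => Jordan n l
  | Kinf n => 1%:M
  | KF n => Gmx F n
  | KFT n => (Gmx F n)^T
  end.

(* t lists the summands of a Kronecker canonical form of (A, B). *)
Definition is_kronecker_form (F : fieldType) (m n : nat) (A B : 'M[F]_(m, n))
    (t : seq (kblock F)) : Prop :=
  all (@kblock_ok F) t /\
  exists (er : sumn (map (@krows F) t) = m) (ec : sumn (map (@kcols F) t) = n),
    equivalent A B (castmx (er, ec) (dsum (@kfst F) t))
                   (castmx (er, ec) (dsum (@ksnd F) t)).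

(* Symmetric tridiagonal matrix with diagonal d and off-diagonal sequence u;
   both are indexed from 0. *)
Definition tridiag (F : fieldType) (n : nat) (d u : nat -> F) : 'M[F]_n :=
  \matrix_(i < n, j < n)
    (if j == i then d i
     else if j == i.+1 :> nat then u i
     else if i == j.+1 :> nat then u j else 0).

(* The diagonal (a, 0, ..., 0) and the off-diagonal sequence a, b, a, b, ... *)
Definition diag1 (F : fieldType) (a : F) (i : nat) : F :=
  if i == 0%N then a else 0.
Definition alt (F : fieldType) (a b : F) (i : nat) : F :=
  if odd i then b else a.

Definition fst_i (F : fieldType) (n : nat) : 'M[F]_n :=
  tridiag n (fun _ => 0) (alt 1 0).
Definition snd_i (F : fieldType) (n : nat) (lambda : F) (eps : bool) : 'M[F]_n :=
  tridiag n (diag1 eps%:R) (alt lambda 1).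
Definition fst_ii (F : fieldType) (n : nat) : 'M[F]_n :=
  tridiag n (diag1 1) (alt 0 1).
Definition snd_ii (F : fieldType) (n : nat) (lambda : F) : 'M[F]_n :=
  tridiag n (diag1 lambda) (alt 1 lambda).

(* Labels: Ti n lambda eps for (fst_i n, snd_i n lambda eps), and
   Tii n lambda for (fst_ii n, snd_ii n lambda). *)
Inductive sblock (F : Type) : Type :=
  | Ti of nat & F & bool
  | Tii of nat & F.

Definition sblock_code (F : Type) (b : sblock F) : nat * F * bool + nat * F :=
  match b with Ti n l e => inl (n, l, e) | Tii n l => inr (n, l) end.
Definition sblock_decode (F : Type) (x : nat * F * bool + nat * F) : sblock F :=
  match x with
  | inl nle => Ti nle.1.1 nle.1.2 nle.2
  | inr nl => Tii nl.1 nl.2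
  end.
Lemma sblock_codeK (F : Type) : cancel (@sblock_code F) (@sblock_decode F).
Proof. by case. Qed.
HB.instance Definition _ (F : eqType) :=
  Equality.copy (sblock F) (can_type (@sblock_codeK F)).

(* On admissible labels the map to pairs of matrices is injective, so permuting
   labels is the same as permuting the summands themselves. *)
Definition sblock_ok (F : fieldType) (b : sblock F) : bool :=
  match b with
  | Ti n lambda eps =>
      [&& (0 < n)%N, ~~ odd n ==> eps & odd n ==> (lambda == 0)]
  | Tii n lambda => (0 < n)%N && (~~ odd n ==> (lambda == 0))
  end.

Definition sdim (F : Type) (b : sblock F) : nat :=
  match b with Ti n _ _ | Tii n _ => n end.
Definition sfst (F : fieldType) (b : sblock F) : 'M[F]_(sdim b, sdim b) :=
  match b return 'M[F]_(sdim b, sdim b) with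
  | Ti n _ _ => fst_i F n
  | Tii n _ => fst_ii F n
  end.
Definition ssnd (F : fieldType) (b : sblock F) : 'M[F]_(sdim b, sdim b) :=
  match b return 'M[F]_(sdim b, sdim b) with
  | Ti n l e => snd_i n l e
  | Tii n l => snd_ii n l
  end.

(* (A, B) is congruent to the direct sum of the tridiagonal pairs listed by s. *)
Definition is_tridiagonal_form (F : fieldType) (n : nat) (A B : 'M[F]_n)
    (s : seq (sblock F)) : Prop :=
  all (@sblock_ok F) s /\
  exists e : sumn (map (@sdim F) s) = n,
    congruent A B (castmx (e, e) (dsum (@sfst F) s))
                  (castmx (e, e) (dsum (@ssnd F) s)).

(* Main.v *)
Require Import Defs.
From mathcomp Require Import all_boot all_order all_algebra.
From mathcomp Require Import fingroup perm.
From mathcomp Require Import zify ring.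
Set Implicit Arguments.
Unset Strict Implicit.
Unset Printing Implicit Defensive.
Import GRing.Theory.
Local Open Scope ring_scope.

(* Equivalent pairs of symmetric matrices are congruent: if M A = A M^T and
   M B = B M^T, then a polynomial square root X of M gives M A = X A X^T and
   M B = X B X^T. It therefore suffices to work up to equivalence.

   Kronecker's theorem is proved by splitting off chains. For a pencil (C, D), a
   chain C v_0 = 0, C v_(i+1) = D v_i spans a summand (J_k(0), I_k) as soon as it
   cannot be prolonged, and a chain of minimal length with D v_k = 0 spans a
   summand (G_k, F_k): by linear duality, the failure of a dual chain of row
   vectors to exist produces a longer, respectively a shorter, chain. The
   multiplicities of the blocks are read off the dimensions of spaces of chains.

   The Kronecker form of a symmetric pair is invariant under transposition, so
   that its blocks (F_k, G_k) and (F_k^T, G_k^T) have equal multiplicities, and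
   it is the Kronecker form of a direct sum of tridiagonal pairs. *)

(** * Equivalence and direct sums *)

(** A summand is recognised by morphisms of pencils into and out of it whose composites are
    invertible. For chains these composites are triangular Toeplitz matrices, so one nonzero corner
    entry suffices, and this entry is the functional to which duality is applied. Finite eigenvalues
    need no separate splitting: if A is invertible and a is an eigenvalue of A^-1 B, then (B - a A,
    A) has a chain. Chains of row vectors are obtained by transposing.

    The row chains that serve as invariants do not see blocks (F_k, G_k), whereas every (F_k^T,
    G_k^T) contributes to the chain spaces of every eigenvalue. The latter are therefore counted on
    their own and cancelled before the Jordan blocks are counted; the former need no count in a
    tridiagonal form, where each summand that contains one also contains its transpose.

    Algebraic closedness supplies both the eigenvalues and the square root. The square root is built
    one eigenvalue at a time, each time from a quadratic equation whose linear coefficient has a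
    factor 2; this is where characteristic 2 is excluded. *)

(* Equivalence of pairs whose sizes are not syntactically equal: the explicit
   two-sided inverses force the sizes to agree and avoid all casts. *)
Definition heqv (F : fieldType) (m n m' n' : nat)
    (A B : 'M[F]_(m, n)) (A' B' : 'M[F]_(m', n')) : Prop :=
  exists (R : 'M_(m', m)) (R' : 'M_(m, m')) (S : 'M_(n, n')) (S' : 'M_(n', n)),
    [/\ R *m R' = 1%:M, R' *m R = 1%:M, S *m S' = 1%:M & S' *m S = 1%:M]
    /\ (A' = R *m A *m S /\ B' = R *m B *m S).

Section Heqv.
Variable F : fieldType.

Lemma inv_dim (m n : nat) (R : 'M[F]_(m, n)) (R' : 'M_(n, m)) :
  R *m R' = 1%:M -> R' *m R = 1%:M -> m = n.
Proof.
by move=> h h'; apply/eqP; rewrite eqn_leq (mulmx1_min h) (mulmx1_min h').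
Qed.

Lemma heqv_dim m n m' n' (A B : 'M[F]_(m, n)) (A' B' : 'M_(m', n')) :
  heqv A B A' B' -> m = m' /\ n = n'.
Proof.
case=> R [R' [S [S' [[h1 h2 h3 h4] _]]]]; split.
  exact: inv_dim h2 h1.
exact: inv_dim h3 h4.
Qed.

Lemma heqv_refl m n (A B : 'M[F]_(m, n)) : heqv A B A B.
Proof.
by exists 1%:M, 1%:M, 1%:M, 1%:M; rewrite !mulmx1 !mul1mx.
Qed.

Lemma heqv_sym m n m' n' (A B : 'M[F]_(m, n)) (A' B' : 'M_(m', n')) :
  heqv A B A' B' -> heqv A' B' A B.
Proof.
case=> R [R' [S [S' [[h1 h2 h3 h4] [-> ->]]]]].
exists R', R, S', S; split; first by split.
have E X : X = R' *m (R *m X *m S) *m S'.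
  by rewrite !mulmxA h2 mul1mx -mulmxA h3 mulmx1.
by split; apply: E.
Qed.

Lemma heqv_trans m n m' n' m2 n2 (A B : 'M[F]_(m, n)) (A' B' : 'M_(m', n'))
    (A2 B2 : 'M_(m2, n2)) :
  heqv A B A' B' -> heqv A' B' A2 B2 -> heqv A B A2 B2.
Proof.
case=> R [R' [S [S' [[h1 h2 h3 h4] [-> ->]]]]].
case=> Q [Q' [T [T' [[k1 k2 k3 k4] [-> ->]]]]].
exists (Q *m R), (R' *m Q'), (S *m T), (T' *m S'); split; last by rewrite !mulmxA.
split; rewrite mulmxA.
- by rewrite -(mulmxA Q) h1 mulmx1.
- by rewrite -(mulmxA R') k2 mulmx1.
- by rewrite -(mulmxA S) k3 mulmx1.
- by rewrite -(mulmxA T') h4 mulmx1.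
Qed.

Lemma heqv_tr m n m' n' (A B : 'M[F]_(m, n)) (A' B' : 'M_(m', n')) :
  heqv A B A' B' -> heqv A^T B^T A'^T B'^T.
Proof.
case=> R [R' [S [S' [[h1 h2 h3 h4] [-> ->]]]]].
exists S^T, S'^T, R^T, R'^T; split; last by rewrite !trmx_mul !mulmxA.
by rewrite -!trmx_mul h1 h2 h3 h4 !trmx1.
Qed.

Lemma heqv_swap m n m' n' (A B : 'M[F]_(m, n)) (A' B' : 'M_(m', n')) :
  heqv A B A' B' -> heqv B A B' A'.
Proof.
case=> R [R' [S [S' [h [eA eB]]]]].
by exists R, R', S, S'.
Qed.

Lemma heqv_lin m n m' n' (A B : 'M[F]_(m, n)) (A' B' : 'M_(m', n')) a :
  heqv A B A' B' -> heqv A (B + a *: A) A' (B' + a *: A').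
Proof.
case=> R [R' [S [S' [h [-> ->]]]]].
exists R, R', S, S'; split=> //.
by rewrite mulmxDr mulmxDl -scalemxAr -scalemxAl.
Qed.

Lemma heqv_cast m n m' n' (A B : 'M[F]_(m, n)) (em : m = m') (en : n = n') :
  heqv A B (castmx (em, en) A) (castmx (em, en) B).
Proof. by case: m' / em; case: n' / en; rewrite !castmx_id; apply: heqv_refl. Qed.

Lemma heqv_block m1 n1 m2 n2 m1' n1' m2' n2'
    (A1 B1 : 'M[F]_(m1, n1)) (A1' B1' : 'M_(m1', n1'))
    (A2 B2 : 'M[F]_(m2, n2)) (A2' B2' : 'M_(m2', n2')) :
  heqv A1 B1 A1' B1' -> heqv A2 B2 A2' B2' ->
  heqv (block_mx A1 0 0 A2) (block_mx B1 0 0 B2)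
       (block_mx A1' 0 0 A2') (block_mx B1' 0 0 B2').
Proof.
case=> R [R' [S [S' [[h1 h2 h3 h4] [-> ->]]]]].
case=> Q [Q' [T [T' [[k1 k2 k3 k4] [-> ->]]]]].
exists (block_mx R 0 0 Q), (block_mx R' 0 0 Q'), (block_mx S 0 0 T),
  (block_mx S' 0 0 T').
by rewrite !mulmx_block ?(mulmx0, mul0mx, addr0, add0r) h1 h2 h3 h4 k1 k2 k3 k4
  -!scalar_mx_block.
Qed.

Lemma heqv_blockC m1 n1 m2 n2 (A1 B1 : 'M[F]_(m1, n1)) (A2 B2 : 'M[F]_(m2, n2)) :
  heqv (block_mx A1 0 0 A2) (block_mx B1 0 0 B2)
       (block_mx A2 0 0 A1) (block_mx B2 0 0 B1).
Proof.
exists (block_mx 0 1%:M 1%:M 0), (block_mx 0 1%:M 1%:M 0),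
  (block_mx 0 1%:M 1%:M 0), (block_mx 0 1%:M 1%:M 0).
by rewrite !mulmx_block ?(mulmx0, mul0mx, addr0, add0r) !mulmx1 !mul1mx
  -!scalar_mx_block.
Qed.

Lemma heqv_blockA m1 n1 m2 n2 m3 n3 (A1 B1 : 'M[F]_(m1, n1))
    (A2 B2 : 'M[F]_(m2, n2)) (A3 B3 : 'M[F]_(m3, n3)) :
  heqv (block_mx A1 0 0 (block_mx A2 0 0 A3)) (block_mx B1 0 0 (block_mx B2 0 0 B3))
       (block_mx (block_mx A1 0 0 A2) 0 0 A3) (block_mx (block_mx B1 0 0 B2) 0 0 B3).
Proof.
have E (X1 : 'M[F]_(m1, n1)) (X2 : 'M[F]_(m2, n2)) (X3 : 'M[F]_(m3, n3)) :
   block_mx X1 0 0 (block_mx X2 0 0 X3) =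
   castmx (esym (addnA _ _ _), esym (addnA _ _ _)) (block_mx (block_mx X1 0 0 X2) 0 0 X3).
  have := @block_mxA _ _ _ _ _ _ _ X1 0 0 0 X2 0 0 0 X3.
  by rewrite /= !row_mx0 !col_mx0.
by rewrite !E; apply: heqv_sym; apply: heqv_cast.
Qed.

Lemma heqv_block0 m n (A B : 'M[F]_(m, n)) :
  heqv (block_mx A 0 0 (0 : 'M_(0, 0))) (block_mx B 0 0 (0 : 'M_(0, 0))) A B.
Proof.
exists (row_mx 1%:M 0), (col_mx 1%:M 0), (col_mx 1%:M 0), (row_mx 1%:M 0).
have E k : col_mx (1%:M : 'M[F]_k) (0 : 'M_(0, k)) *m row_mx 1%:M 0 = 1%:M.
  rewrite mul_col_row !mulmx1 [RHS]scalar_mx_block.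
  by rewrite mul0mx; congr block_mx; rewrite ?mulmx0 // [RHS]flatmx0.
rewrite !E !mul_row_col !mulmx1 !mul1mx !mul0mx !addr0.
by rewrite !mul_row_col !mulmx1 !mul0mx !addr0.
Qed.

Lemma heqv_reindex m n m' n' (A B : 'M[F]_(m, n)) (A' B' : 'M_(m', n'))
    (f : 'I_m' -> 'I_m) (g : 'I_n' -> 'I_n) :
  injective f -> injective g -> m = m' -> n = n' ->
  (forall i j, A' i j = A (f i) (g j)) -> (forall i j, B' i j = B (f i) (g j)) ->
  heqv A B A' B'.
Proof.
move=> fI gI em en; case: m' / em f fI A' B' => f fI A' B'.
case: n' / en g gI A' B' => g gI A' B' hA hB.
pose p := perm fI; pose q := perm gI.
exists (perm_mx p), (perm_mx p^-1%g), (perm_mx q^-1%g), (perm_mx q).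
have E X : perm_mx p *m X *m perm_mx q^-1%g = col_perm q (row_perm p X).
  by rewrite row_permE col_permE.
rewrite !E; split; first by rewrite -!perm_mxM !mulVg !mulgV !perm_mx1.
by split; apply/matrixP=> i j; rewrite ?hA ?hB !mxE !permE.
Qed.

End Heqv.

Section DsumHeqv.
Variables (F : fieldType) (L : eqType) (r c : L -> nat).
Variables (M N : forall x : L, 'M[F]_(r x, c x)).

Lemma dsum_perm (s t : seq L) : perm_eq s t ->
  heqv (dsum M s) (dsum N s) (dsum M t) (dsum N t).
Proof.
elim: s t => [|x s IH] t.
  by rewrite perm_sym => /perm_nilP ->; apply: heqv_refl.
move=> st.
have /path.splitPr tx : x \in t by rewrite -(perm_mem st) mem_head.
case: tx st => t1 t2 st.
have {}st : perm_eq s (t1 ++ t2).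
  by rewrite -(perm_cons x) (perm_trans st) // -(cat1s x t2) perm_catCA.
apply: (heqv_trans (heqv_block (heqv_refl (M x) (N x)) (IH _ st))).
elim: t1 {st IH} => [|y t1 IH] /=; first exact: heqv_refl.
apply: (heqv_trans _ (heqv_block (heqv_refl (M y) (N y)) IH)).
apply: (heqv_trans (heqv_blockA _ _ _ _ _ _)).
apply: (heqv_trans (heqv_block (heqv_blockC _ _ _ _) (heqv_refl _ _))).
by apply: heqv_sym; apply: heqv_blockA.
Qed.

Lemma dsum_cat (s t : seq L) :
  heqv (dsum M (s ++ t)) (dsum N (s ++ t))
    (block_mx (dsum M s) 0 0 (dsum M t)) (block_mx (dsum N s) 0 0 (dsum N t)).
Proof.
elim: s => [|x s IH] /=.
  apply: heqv_sym; apply: (heqv_trans (heqv_blockC _ _ _ _)); exact: heqv_block0.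
apply: (heqv_trans (heqv_block (heqv_refl _ _) IH)); exact: heqv_blockA.
Qed.

End DsumHeqv.

(** * Splitting off chains *)

Section Splitting.
Variable F : fieldType.

Lemma mulmx_selr m n p (X : 'M[F]_(m, p)) (Y : 'M_(p, n)) i j k0 :
  (forall k, Y k j = (k == k0)%:R) -> (X *m Y) i j = X i k0.
Proof.
move=> h; rewrite mxE (bigD1 k0) //= h eqxx mulr1 big1 ?addr0 // => k /negPf kk.
by rewrite h kk mulr0.
Qed.

Lemma mulmx_sell m n p (X : 'M[F]_(m, p)) (Y : 'M_(p, n)) i j k0 :
  (forall k, X i k = (k == k0)%:R) -> (X *m Y) i j = Y k0 j.
Proof.
move=> h; rewrite mxE (bigD1 k0) //= h eqxx mul1r big1 ?addr0 // => k /negPf kk.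
by rewrite h kk mul0r.
Qed.

Lemma mulmx_zeror m n p (X : 'M[F]_(m, p)) (Y : 'M_(p, n)) i j :
  (forall k, Y k j = 0) -> (X *m Y) i j = 0.
Proof. by move=> h; rewrite mxE big1 // => k _; rewrite h mulr0. Qed.

(** A rank factorization [K *m L] of the complementary idempotent [1%:M - V *m S] gives the
    inclusion of a complement and the projection onto it. *)
Lemma retract_complement q n (S : 'M[F]_(q, n)) (V : 'M_(n, q)) :
  S *m V = 1%:M -> exists r (K : 'M_(n, r)) (L : 'M_(r, n)),
  [/\ L *m V = 0, S *m K = 0, L *m K = 1%:M & V *m S + K *m L = 1%:M].
Proof.
move=> SV; pose E := 1%:M - V *m S.
have SE : S *m E = 0 by rewrite mulmxBr mulmx1 mulmxA SV mul1mx subrr.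
have EV : E *m V = 0 by rewrite mulmxBl mul1mx -mulmxA SV mulmx1 subrr.
have EE : E *m E = E by rewrite {1}/E mulmxBl mul1mx -mulmxA SE mulmx0 subr0.
have [r [K [L [KL [K' KK] [L' LL]]]]] : exists r (K : 'M_(n, r)) (L : 'M_(r, n)),
    [/\ K *m L = E, exists K', K' *m K = 1%:M & exists L', L *m L' = 1%:M].
  exists (\rank E), (col_base E), (row_base E); split; first exact: mulmx_base.
    exact/row_fullP/col_base_full.
  exact/row_freeP/row_base_free.
exists r, K, L; split; last by rewrite KL addrC subrK.
- by rewrite -[L]mul1mx -KK -(mulmxA K') KL -mulmxA EV mulmx0.
- by rewrite -[K]mulmx1 -LL (mulmxA K) KL mulmxA SE mul0mx.
- transitivity (K' *m (E *m E) *m L').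
    by rewrite -KL !mulmxA KK mul1mx -!mulmxA LL mulmx1.
  by rewrite EE -KL !mulmxA KK mul1mx.
Qed.

(** [(V, W)] is a morphism from the pencil [(P, Q)] to [(A, B)] and [(S, R)] one in the other
    direction. The composites [S *m V] and [R *m W] intertwine [P] and [Q], so normalizing by their
    inverses still gives morphisms and makes [(P, Q)] a retract, hence a summand. *)
Lemma split_retract m n p q (A B : 'M[F]_(m, n)) (P Q : 'M_(p, q))
    (V : 'M_(n, q)) (W : 'M_(m, p)) (S : 'M_(q, n)) (R : 'M_(p, m)) :
  A *m V = W *m P -> B *m V = W *m Q -> R *m A = P *m S -> R *m B = Q *m S ->
  S *m V \in unitmx -> R *m W \in unitmx ->
  exists m2 n2 (A2 B2 : 'M[F]_(m2, n2)),
    heqv A B (block_mx P 0 0 A2) (block_mx Q 0 0 B2).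
Proof.
move=> AV BV RA RB uS uR.
pose S1 := invmx (S *m V) *m S; pose R1 := invmx (R *m W) *m R.
have SV : S1 *m V = 1%:M by rewrite -mulmxA mulVmx.
have RW : R1 *m W = 1%:M by rewrite -mulmxA mulVmx.
have H X Y : X *m V = W *m Y -> R *m X = Y *m S -> R1 *m X = Y *m S1.
  move=> XV RX; have E : R *m W *m Y = Y *m (S *m V).
    by rewrite -mulmxA -XV mulmxA RX mulmxA.
  rewrite -mulmxA RX; apply: (canLR (mulKmx uR)).
  by rewrite [RHS]mulmxA E /S1 -!mulmxA (mulmxA S) mulKVmx.
have [r [K [L [LV SK LK VSKL]]]] := retract_complement SV.
have [r2 [K2 [L2 [LV2 SK2 LK2 VSKL2]]]] := retract_complement RW.
have {}RA := H _ _ AV RA; have {}RB := H _ _ BV RB.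
clearbody S1 R1.
exists r2, r, (L2 *m A *m K), (L2 *m B *m K).
exists (col_mx R1 L2), (row_mx W K2), (row_mx V K), (col_mx S1 L).
rewrite !mul_row_col VSKL VSKL2 !mul_col_row SV RW SK SK2 LV LV2 LK LK2.
rewrite -!scalar_mx_block; split=> //.
have Z X Y : X *m V = W *m Y -> R1 *m X = Y *m S1 ->
    block_mx Y 0 0 (L2 *m X *m K) = col_mx R1 L2 *m X *m row_mx V K.
  move=> XV RX; rewrite mul_col_mx RX mul_col_row -!mulmxA SV SK XV (mulmxA L2 W) LV2.
  by rewrite mulmx1 mulmx0 mul0mx.
by split; apply: Z.
Qed.

(** The rows of [1%:M - M *m pinvmx M] lie in the left kernel of [M]; if all of them kill [c], then
    [pinvmx M *m c] is a solution. *)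
Lemma kernel_dual p q (M : 'M[F]_(p, q)) (c : 'cV_p) :
  (exists2 x : 'rV_p, x *m M = 0 & x *m c != 0) \/ exists y, c = M *m y.
Proof.
have [->|/eqP ne] := eqVneq c (M *m (pinvmx M *m c)); first by right; eexists.
left; pose E := 1%:M - M *m pinvmx M.
have [i ni] : exists i, row i (E *m c) != 0.
  apply/existsP; apply: contra_notT ne; rewrite negb_exists => /forallP h.
  apply/eqP; rewrite -subr_eq0 mulmxA -{1}[c]mul1mx -mulmxBl; apply/eqP/row_matrixP=> i.
  by have /negPn/eqP -> := h i; rewrite row0.
exists (row i E); rewrite -row_mul //.
by rewrite mulmxBl mul1mx mulmxKpV // subrr row0.
Qed.

(* Linear duality: a functional of R vanishing on the kernel of the constraint
   map R |-> P R C - Q R D factors through it. *)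
Lemma chain_dual k l m n (C D : 'M[F]_(m, n)) (P Q : 'M_(l, k)) (e : 'rV_k)
    (z : 'cV_m) :
  (exists2 R : 'M_(k, m), P *m R *m C = Q *m R *m D & e *m R *m z != 0) \/
  exists Y : 'M_(n, l), z *m e = C *m Y *m P - D *m Y *m Q.
Proof.
pose M := lin_mx (mulmxr C \o mulmx P) - lin_mx (mulmxr D \o mulmx Q).
have ME R : mxvec R *m M = mxvec (P *m R *m C - Q *m R *m D).
  by rewrite mulmxBr !mul_vec_lin linearB.
(* The functional [R |-> e *m R *m z] is the dot product with [mxvec (e^T *m z^T)]. *)
have [[x xM xc]|[y yP]] := kernel_dual M (mxvec (e^T *m z^T))^T.
  left; exists (vec_mx x).
    apply/eqP; rewrite -subr_eq0 -(inj_eq (can_inj mxvecK)) -ME vec_mxK xM.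
    by rewrite linear0.
  apply: contra_neq xc => h; rewrite -[LHS]trmxK trmx_mul !trmxK.
  by rewrite -[x]vec_mxK mxvec_dotmul trmxK h trmx0.
right; exists (vec_mx y^T)^T; set Y := vec_mx _.
have yE : y = (mxvec Y)^T by rewrite vec_mxK trmxK.
apply/eqP; rewrite -subr_eq0; apply/eqP/trmx_inj; rewrite trmx0.
suff h (u : 'rV_k) (v : 'rV_m) :
   u *m (z *m e - (C *m Y^T *m P - D *m Y^T *m Q))^T *m v^T = 0.
  apply/matrixP=> i j; have := h (delta_mx 0 i) (delta_mx 0 j).
  by move/matrixP/(_ 0 0); rewrite -rowE trmx_delta -colE !mxE.
have := congr1 (mulmx (mxvec (u^T *m v))) yP.
rewrite mulmxA ME yE raddfB mulmxBl mxvec_dotmul.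
have E1 (X : 'M_(l, k)) (Z : 'M_(m, n)) :
    X *m (u^T *m v) *m Z = (u *m X^T)^T *m (v *m Z).
  by rewrite trmx_mul trmxK !mulmxA.
rewrite !E1 !mxvec_dotmul => h.
have -> : (z *m e - (C *m Y^T *m P - D *m Y^T *m Q))^T =
    e^T *m z^T - (P^T *m Y *m C^T - Q^T *m Y *m D^T).
  have trB (X Z : 'M_(m, k)) : (X - Z)^T = X^T - Z^T by apply/matrixP=> ? ?; rewrite !mxE.
  by rewrite !trB !trmx_mul !trmxK !mulmxA.
rewrite !(mulmxBl, mulmxBr) !mulmxA in h *; rewrite h.
by rewrite !trmx_mul !mulmxA subrr.
Qed.

(** Such a [T] is constant along diagonals and upper triangular, so its determinant is a power of
    [T 0 0]. *)
Lemma toeplitz_unit k (T : 'M[F]_k.+1) :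
  (forall i j i' j' : 'I_k.+1, i' = i.+1 :> nat -> j' = j.+1 :> nat ->
     T i' j' = T i j) ->
  (forall i : 'I_k.+1, (0 < i)%N -> T i 0 = 0) -> T 0 0 != 0 -> T \in unitmx.
Proof.
move=> hS h0 nz; rewrite -unitmx_tr unitmxE det_trig.
  rewrite unitfE; apply/prodf_neq0 => i _; rewrite mxE.
  suff -> : T i i = T 0 0 by [].
  case: i => i ilt; elim: i ilt => [|i IH] ilt; first by congr (T _ _); apply: val_inj.
  by rewrite (hS (Ordinal (ltnW ilt)) (Ordinal (ltnW ilt))).
apply/is_trig_mxP => i j ij; rewrite mxE.
case: i ij => i ilt /=; elim: i ilt j => [|i IH] ilt j ij.
  by rewrite (_ : Ordinal ilt = 0) ?h0 //; apply: val_inj.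
case: j ij => [[|j] jlt] //= ij.
by rewrite (hS (Ordinal (ltnW jlt)) (Ordinal (ltnW ilt))) // IH.
Qed.

Definition chain m n (C D : 'M[F]_(m, n)) (k : nat) (v : nat -> 'cV[F]_n) :=
  C *m v 0%N = 0 /\ forall i, (i.+1 < k)%N -> C *m v i.+1 = D *m v i.

(** Equivalently, the polynomial vector with coefficients [v 0], ..., [v k] is annihilated by the
    pencil C - x D and has a nonzero constant term. *)
Definition singular_chain m n (C D : 'M[F]_(m, n)) (k : nat) :=
  exists v, [/\ v 0%N != 0, chain C D k.+1 v & D *m v k = 0].

Lemma Jordan0E n i j : @Jordan F n 0 i j = (j == i.+1 :> nat)%:R.
Proof. by rewrite mxE; case: eqVneq => [->|_]; [rewrite ltn_eqF | case: eqP]. Qed.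

Lemma mul_Jordan0 m n (X : 'M[F]_(m, n)) i (j k : 'I_n) :
  j = k.+1 :> nat -> (X *m Jordan n 0) i j = X i k.
Proof. by move=> jk; apply: mulmx_selr => l; rewrite Jordan0E jk eqSS eq_sym. Qed.

Lemma mul_Jordan00 m n (X : 'M[F]_(m, n)) i (j : 'I_n) :
  j = 0%N :> nat -> (X *m Jordan n 0) i j = 0.
Proof. by move=> j0; apply: mulmx_zeror => l; rewrite Jordan0E j0. Qed.

Lemma Jordan0_mul m n (X : 'M[F]_(n, m)) (i k : 'I_n) j :
  k = i.+1 :> nat -> (Jordan n 0 *m X) i j = X k j.
Proof. by move=> ik; apply: mulmx_sell => l; rewrite Jordan0E -ik. Qed.

Lemma mul_Gmx m n (X : 'M[F]_(m, n)) i (k : 'I_n) (j : 'I_n.+1) :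
  j = k.+1 :> nat -> (X *m Gmx F n) i j = X i k.
Proof. by move=> jk; apply: mulmx_selr => l; rewrite mxE jk eqSS eq_sym. Qed.

Lemma mul_Gmx0 m n (X : 'M[F]_(m, n)) i : (X *m Gmx F n) i 0 = 0.
Proof. by apply: mulmx_zeror => l; rewrite mxE. Qed.

Lemma mul_Fmx m n (X : 'M[F]_(m, n)) i (k : 'I_n) (j : 'I_n.+1) :
  j = k :> nat -> (X *m Fmx F n) i j = X i k.
Proof. by move=> jk; apply: mulmx_selr => l; rewrite mxE jk eq_sym. Qed.

Lemma mul_Fmx0 m n (X : 'M[F]_(m, n)) i : (X *m Fmx F n) i ord_max = 0.
Proof. by apply: mulmx_zeror => l; rewrite mxE gtn_eqF. Qed.

Lemma Gmx_mul m n (X : 'M[F]_(n.+1, m)) (i : 'I_n) (k : 'I_n.+1) j :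
  k = i.+1 :> nat -> (Gmx F n *m X) i j = X k j.
Proof. by move=> ik; apply: mulmx_sell => l; rewrite mxE -ik. Qed.

Lemma Fmx_mul m n (X : 'M[F]_(n.+1, m)) (i : 'I_n) (k : 'I_n.+1) j :
  k = i :> nat -> (Fmx F n *m X) i j = X k j.
Proof. by move=> ik; apply: mulmx_sell => l; rewrite mxE -ik. Qed.

Lemma mul_col (m n p : nat) (A : 'M[F]_(m, n)) (X : 'M_(n, p)) i j :
  (A *m col j X) i 0 = (A *m X) i j.
Proof. by rewrite colE mulmxA -colE mxE. Qed.

Definition cols_mx n k (v : nat -> 'cV[F]_n) : 'M_(n, k) := \matrix_(i, j) v j i 0.

Lemma mul_cols_mx m n k (A : 'M[F]_(m, n)) v (i : 'I_m) (j : 'I_k) :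
  (A *m cols_mx k v) i j = (A *m v j) i 0.
Proof. by rewrite !mxE; apply: eq_bigr => l _; rewrite mxE. Qed.

(** The chain is a morphism from the block into the pencil. A dual chain [R] with
    [R *m C = N *m (R *m D)] would be a morphism back, and the composite [R *m D *m V] commutes with
    the nilpotent Jordan block [N], so it is Toeplitz. *)
Lemma split_nilpotent m n (C D : 'M[F]_(m, n)) k v :
  v 0%N != 0 -> chain C D k.+1 v ->
  (exists m2 n2 (C2 D2 : 'M[F]_(m2, n2)),
     heqv C D (block_mx (Jordan k.+1 0) 0 0 C2) (block_mx 1%:M 0 0 D2)) \/
  (exists2 v', v' 0%N != 0 & chain C D k.+2 v').
Proof.
move=> v0 [Cv0 CvS].
pose V : 'M_(n, k.+1) := cols_mx k.+1 v; pose N : 'M[F]_k.+1 := Jordan k.+1 0.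
have CV : C *m V = D *m V *m N.
  apply/matrixP=> i j; rewrite mul_cols_mx.
  case: j => [[|j] jlt] /=; first by rewrite mul_Jordan00 // Cv0 mxE.
  by rewrite (@mul_Jordan0 _ _ _ _ _ (Ordinal (ltnW jlt))) // mul_cols_mx CvS.
have [[R RC Rz]|[Y]] := chain_dual C D 1%:M N (delta_mx 0 0) (D *m v 0%N).
  left; rewrite mul1mx in RC.
  have T00 : (R *m D *m V) 0 0 != 0.
    apply: contra_neq Rz => h; apply/matrixP=> i j; rewrite !ord1 [RHS]mxE -h.
    by rewrite mul_cols_mx -(mulmxA (delta_mx 0 0)) -rowE [LHS]mxE mulmxA.
  have TN : R *m D *m V *m N = N *m (R *m D *m V).
    transitivity (R *m (C *m V)); first by rewrite CV !mulmxA.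
    by rewrite mulmxA RC !mulmxA.
  have uT : R *m D *m V \in unitmx.
    apply: toeplitz_unit T00 => [i j i' j' ii' jj'|i i0].
      rewrite -(@Jordan0_mul _ _ _ i _ _ ii') -TN; exact: mul_Jordan0.
    have lt : (i.-1 < k.+1)%N by apply: leq_trans (ltn_ord i); rewrite ltnS leq_pred.
    by rewrite -(@Jordan0_mul _ _ _ (Ordinal lt)) ?prednK // -TN mul_Jordan00.
  apply: (@split_retract _ _ _ _ C D N 1%:M V (D *m V) (R *m D) R) => //.
  - by rewrite mulmx1.
  - by rewrite RC mulmxA.
  - by rewrite mul1mx.
  - by rewrite mulmxA.
rewrite mulmx1 => YE; right.
(* The columns of [Y] continue the chain from [v 0]; the old vectors [v 1], ..., [v k] are
   discarded. *)
exists (fun i => if i is i'.+1 then col (inord i') Y else v 0%N) => //; split=> // i ik.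
have {}YE : C *m Y = D *m v 0%N *m delta_mx 0 0 + D *m Y *m N by rewrite YE subrK.
apply/colP=> a; rewrite ltnS in ik; rewrite /= mul_col YE [LHS]mxE.
case: i ik => [|i] ik /=.
  rewrite mul_Jordan00 ?inordK // addr0 mxE big_ord1 [delta_mx _ _ _ _]mxE
    (_ : inord 0 = 0).
    by rewrite !eqxx mulr1.
  by apply: val_inj; rewrite /= inordK.
rewrite (@mul_Jordan0 _ _ _ _ _ (inord i)) ?inordK //; last exact: ltnW.
rewrite mxE big_ord1 [delta_mx _ _ _ _]mxE (_ : inord i.+1 == 0 = false).
  by rewrite andbF mulr0 add0r mul_col.
by apply/negP=> /eqP/(congr1 val); rewrite /= inordK.
Qed.

End Splitting.

(** * Singular chains *)

Section Singular.
Variable F : fieldType.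

Lemma split_singular0 m n (C D : 'M[F]_(m, n)) (v : 'cV_n) :
  v != 0 -> C *m v = 0 -> D *m v = 0 ->
  exists m2 n2 (C2 D2 : 'M[F]_(m2, n2)),
    heqv C D (block_mx (Gmx F 0) 0 0 C2) (block_mx (Fmx F 0) 0 0 D2).
Proof.
move=> v0 Cv Dv.
have [i vi] : exists i, v i 0 != 0.
  apply/existsP; apply: contra_neqT v0; rewrite negb_exists => /forallP h.
  by apply/colP=> i; rewrite mxE; apply/eqP; rewrite -[_ == _]negbK h.
have E (X : 'M[F]_(0, 1)) (Y : 'M[F]_(m, 0)) : Y *m X = 0.
  by rewrite [X]flatmx0 mulmx0.
apply: (@split_retract _ _ _ _ _ C D _ _ v 0 (delta_mx 0 i) 0);
  rewrite ?E ?Cv ?Dv //.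
- by rewrite [LHS]flatmx0 [RHS]flatmx0.
- by rewrite [LHS]flatmx0 [RHS]flatmx0.
- rewrite unitmxE det_mx11 -rowE mxE unitfE; exact: vi.
- by rewrite unitmxE det_mx00 unitr1.
Qed.

(** The dual system asks that row [i] of [R *m C] be row [i.+1] of [R *m D], with row 0 of [R *m D]
    nonzero on [v 0]. If it has no solution, duality returns a singular chain with the same start
    and one vector fewer. *)
Lemma split_singularS m n (C D : 'M[F]_(m, n)) k :
  singular_chain C D k.+1 ->
  (exists m2 n2 (C2 D2 : 'M[F]_(m2, n2)),
     heqv C D (block_mx (Gmx F k.+1) 0 0 C2) (block_mx (Fmx F k.+1) 0 0 D2)) \/
  singular_chain C D k.
Proof.
case=> v [v0 [Cv0 CvS] Dvk].
pose V : 'M_(n, k.+2) := cols_mx k.+2 v; pose W := D *m cols_mx k.+1 v.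
have CV : C *m V = W *m Gmx F k.+1.
  apply/matrixP=> i j; rewrite mul_cols_mx.
  case: (unliftP 0 j) => [j' ->|->]; last by rewrite mul_Gmx0 Cv0 mxE.
  rewrite (@mul_Gmx _ _ _ _ _ j') // mul_cols_mx lift0 CvS //.
  exact: (ltn_ord j').
have DV : D *m V = W *m Fmx F k.+1.
  apply/matrixP=> i j; rewrite mul_cols_mx.
  case: (unliftP ord_max j) => [j' ->|->]; last by rewrite mul_Fmx0 Dvk mxE.
  by rewrite (@mul_Fmx _ _ _ _ _ j') ?lift_max // mul_cols_mx.
have WE : W = D *m cols_mx k.+1 v by [].
clearbody W.
have [[R RC Rz]|[Y YE]] :=
  chain_dual C D (Fmx F k) (Gmx F k) (delta_mx 0 0) (D *m v 0%N).
  (* The rows of [R *m D] followed by the last row of [R *m C]: by the dual system, the rows of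
     [R *m C] are then those of [S] shifted by one. *)
  left; pose S : 'M_(k.+2, n) :=
    \matrix_(i, j) if unlift ord_max i is Some i' then (R *m D) i' j
                   else (R *m C) ord_max j.
  have FS : R *m D = Fmx F k.+1 *m S.
    apply/matrixP=> i j; rewrite (@Fmx_mul _ _ _ _ _ (lift ord_max i)) ?lift_max //.
    by rewrite [RHS]mxE liftK.
  have GS : R *m C = Gmx F k.+1 *m S.
    apply/matrixP=> i j; rewrite (@Gmx_mul _ _ _ _ _ (lift 0 i)) //.
    rewrite [RHS]mxE; case: unliftP => [i' e|e].
      have {}e : i.+1 = i' by have := congr1 (@nat_of_ord _) e; rewrite lift_max lift0.
      have ilt : (i < k)%N by rewrite -ltnS e.
      have := congr1 (fun X : 'M_(k, n) => X (Ordinal ilt) j) RC.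
      by rewrite -!mulmxA (@Fmx_mul _ _ _ _ _ i) // (@Gmx_mul _ _ _ _ _ i').
    by congr ((R *m C) _ j); apply: val_inj; case: (congr1 (@nat_of_ord _) e).
  have FT : Fmx F k.+1 *m (S *m V) = R *m W *m Fmx F k.+1.
    by rewrite mulmxA -FS -!mulmxA DV.
  have GT : Gmx F k.+1 *m (S *m V) = R *m W *m Gmx F k.+1.
    by rewrite mulmxA -GS -!mulmxA CV.
  (* [R *m W] is both the upper left and the lower right corner of [S *m V]; hence both matrices are
     constant along diagonals. *)
  have UT (i j : 'I_k.+1) (i' j' : 'I_k.+2) : i' = i :> nat -> j' = j :> nat ->
      (R *m W) i j = (S *m V) i' j'.
    by move=> ii jj; rewrite -(@mul_Fmx _ _ _ _ _ _ j') // -FT (@Fmx_mul _ _ _ _ _ i').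
  have TS (i j : 'I_k.+1) (i' j' : 'I_k.+2) : i' = i.+1 :> nat -> j' = j.+1 :> nat ->
      (R *m W) i j = (S *m V) i' j'.
    by move=> ii jj; rewrite -(@mul_Gmx _ _ _ _ _ _ j') // -GT (@Gmx_mul _ _ _ _ _ i').
  have T0 (i : 'I_k.+2) : (0 < i)%N -> (S *m V) i 0 = 0.
    move=> i0; have lt : (i.-1 < k.+1)%N by rewrite prednK // -ltnS.
    by rewrite -(@Gmx_mul _ _ _ _ (Ordinal lt)) ?prednK // GT mul_Gmx0.
  have U00 : (R *m W) 0 0 != 0.
    apply: contra_neq Rz => h; apply/matrixP=> i j; rewrite !ord1 [RHS]mxE -h.
    by rewrite WE (mulmxA R D) mul_cols_mx -(mulmxA (delta_mx 0 0)) -rowE [LHS]mxE mulmxA.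
  apply: (@split_retract _ _ _ _ _ C D _ _ V W S R) => //.
    apply: toeplitz_unit => //; last by rewrite -(UT 0 0).
    move=> i j i' j' ii jj.
    have il : (i < k.+1)%N by rewrite -ltnS -ii.
    have jl : (j < k.+1)%N by rewrite -ltnS -jj.
    by rewrite -(TS (Ordinal il) (Ordinal jl) i' j') // (UT _ _ i j).
  apply: toeplitz_unit => //.
    move=> i j i' j' ii jj.
    rewrite (UT i' j' (lift ord_max i') (lift ord_max j')) ?lift_max //.
    by rewrite (TS i j (lift ord_max i') (lift ord_max j')) ?lift_max.
  by move=> i i0; rewrite (UT i 0 (lift ord_max i) 0) ?lift_max // T0 ?lift_max.
right.
(* The default value 0 at index [k] turns the final condition of a singular chain into the last
   instance of the recurrence [yu]. *)
pose y i : 'cV_n := oapp (fun l : 'I_k => col l Y) 0 (insub i).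
pose u i := if i is i'.+1 then y i' else v 0%N.
have yk : y k = 0 by rewrite /y insubN ?ltnn.
have yu (j : 'I_k.+1) : C *m y j = D *m u j.
  have CY a : (C *m y j) a 0 = (C *m Y *m Fmx F k) a j.
    case: (unliftP ord_max j) => [l ->|->]; last by rewrite yk mul_Fmx0 mulmx0 mxE.
    by rewrite (@mul_Fmx _ _ _ _ _ l) ?lift_max // /y valK /= mul_col.
  apply/colP=> a; rewrite CY.
  have := congr1 (fun X : 'M_(m, k.+1) => X a j) YE; rewrite [RHS]mxE [X in _ = _ + X]mxE.
  case: (unliftP 0 j) => [l ->|->].
    rewrite (@mul_Gmx _ _ _ _ _ l) // mxE big_ord1 [delta_mx _ _ _ _]mxE.
    rewrite andbF mulr0 => /eqP; rewrite eq_sym subr_eq0 => /eqP ->.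
    by rewrite lift0 /= /y valK /= mul_col.
  by rewrite mul_Gmx0 subr0 mxE big_ord1 [delta_mx _ _ _ _]mxE mulr1.
exists u; split=> //; last by rewrite -(yu ord_max) yk mulmx0.
by split=> // i ik; rewrite ltnS in ik; rewrite -(yu (Ordinal (leqW ik))).
Qed.

Lemma split_singular m n (C D : 'M[F]_(m, n)) k :
  singular_chain C D k ->
  exists l m2 n2 (C2 D2 : 'M[F]_(m2, n2)),
     heqv C D (block_mx (Gmx F l) 0 0 C2) (block_mx (Fmx F l) 0 0 D2).
Proof.
elim: k => [|k IH] sing.
  case: sing => v [v0 [Cv _] Dv]; exists 0%N; exact: split_singular0 Cv Dv.
case: (split_singularS sing) => // [[m2 [n2 [C2 [D2 h]]]]].
by exists k.+1, m2, n2, C2, D2.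
Qed.

(* A chain longer than the number of columns is linearly dependent, and the
   shift-invariant combination given by a dependence relation breaks off. *)
Lemma long_chain_singular m n (C D : 'M[F]_(m, n)) v :
  v 0%N != 0 -> chain C D n.+1 v -> exists k, singular_chain C D k.
Proof.
move=> v0 [Cv0 CvS].
have [x x0 xV] : exists2 x : nat -> F, exists2 j, (j <= n)%N & x j != 0 &
    \sum_(i < n.+1) x i *: v i = 0.
  pose V := (cols_mx n.+1 v)^T.
  have : kermx V != 0 by rewrite kermx_eq0 /row_free ltn_eqF // ltnS rank_leq_col.
  case/rowV0Pn=> r /sub_kermxP rV r0.
  exists (fun i => if insub i is Some l then r 0 l else 0).
    have [i ri] : exists i, r 0 i != 0.
      apply/existsP; apply: contra_neqT r0; rewrite negb_exists => /forallP h.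
      by apply/rowP=> i; rewrite mxE; apply/eqP; rewrite -[_ == _]negbK h.
    by exists i; rewrite ?valK // -ltnS.
  apply/colP=> a; rewrite summxE [RHS]mxE; have := congr1 (fun X : 'rV_n => X 0 a) rV.
  rewrite mxE [RHS]mxE => h; rewrite -[RHS]h.
  by apply: eq_bigr => i _; rewrite valK !mxE.
(* [j] is the last index with a nonzero coefficient, which makes [y 0 = x j *: v 0] nonzero
   below. *)
have {x0 xV} [j [jn xj xV]] : exists j, [/\ (j <= n)%N, x j != 0 &
    \sum_(i < j.+1) x i *: v i = 0].
  have [j /andP[jn xj] jmax] := ex_maxnP (P := fun j => (j <= n)%N && (x j != 0)) (m := n)
     (let: ex_intro2 j a b := x0 in ex_intro _ j (introT andP (conj a b)))
     (fun j h => proj1 (andP h)).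
  exists j; split=> //; rewrite -[RHS]xV (big_ord_widen n.+1 (fun i => x i *: v i)) //.
  rewrite [RHS](bigID (fun i : 'I__ => (i < j.+1)%N)) /= [X in _ + X]big1 ?addr0 // => i ij.
  suff -> : x i = 0 by rewrite scale0r.
  by apply: contraNeq ij => xi; rewrite ltnS jmax // xi andbT -ltnS.
(* The relation with all indices of [v] lowered by [j - i] and the terms of negative index dropped;
   [y j] is the relation itself. *)
pose y i := \sum_(p < i.+1) x (p + j - i)%N *: v p.
have yj : y j = 0 by rewrite -[RHS]xV; apply: eq_bigr => p _; rewrite addnK.
have y0 : y 0%N != 0 by rewrite /y big_ord1 subn0 scaler_eq0 negb_or xj.
have yS i : (i < j)%N -> C *m y i.+1 = D *m y i.
  move=> ij; rewrite /y big_ord_recl mulmxDr -scalemxAr Cv0 scaler0 add0r !mulmx_sumr.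
  apply: eq_bigr => p _; rewrite -!scalemxAr lift0 CvS; last first.
    by rewrite ltnS (leq_trans (ltn_ord p)) // (leq_trans ij).
  by rewrite addSn subSS.
case: j => [|j] in jn xj xV y yj y0 yS *; first by rewrite yj eqxx in y0.
exists j, y; split=> //; last by rewrite -yS // yj mulmx0.
split; last by move=> i ij; exact: yS (ltnW ij).
by rewrite /y big_ord1 -scalemxAr Cv0 scaler0.
Qed.

(** A kernel vector is a chain of length one. It is prolonged until it splits off or has more
    vectors than there are columns, and in the latter case a singular chain exists; [d] bounds the
    remaining prolongations. *)
Lemma split_kernel m n (C D : 'M[F]_(m, n)) (v : 'cV_n) :
  v != 0 -> C *m v = 0 -> (exists k, singular_chain C D k) \/
  exists k m2 n2 (C2 D2 : 'M[F]_(m2, n2)),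
     heqv C D (block_mx (Jordan k.+1 0) 0 0 C2) (block_mx 1%:M 0 0 D2).
Proof.
move=> v0 Cv.
suff H k d : n = (k + d)%N -> (exists2 w, w 0%N != 0 & chain C D k.+1 w) ->
  (exists k, singular_chain C D k) \/
  exists k m2 n2 (C2 D2 : 'M[F]_(m2, n2)),
     heqv C D (block_mx (Jordan k.+1 0) 0 0 C2) (block_mx 1%:M 0 0 D2).
  by apply: (H 0%N n) => //; exists (fun=> v).
elim: d k => [|d IH] k nk [w w0 wC].
  by left; apply: long_chain_singular w0 _; rewrite addn0 in nk; rewrite -nk in wC.
have [[m2 [n2 [C2 [D2 h]]]]|[w' w0' wC']] := split_nilpotent w0 wC.
  by right; exists k, m2, n2, C2, D2.
by apply: (IH k.+1); [rewrite addSnnS | exists w'].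
Qed.

End Singular.

(** * Existence of the Kronecker form *)

Section KroneckerField.
Variable F : fieldType.

Lemma Gmx_Fmx_rev k : heqv (Gmx F k) (Fmx F k) (Fmx F k) (Gmx F k).
Proof.
apply: (heqv_reindex (f := @rev_ord k) (g := @rev_ord k.+1)) => //;
  try exact: rev_ord_inj; move=> i j; rewrite !mxE /=; congr (_%:R);
  by case: i j => [i il] [j jl] /=; lia.
Qed.

Lemma Jordan0_tr_rev k :
  heqv (Jordan k 0)^T 1%:M (Jordan k (0 : F)) 1%:M.
Proof.
apply: (heqv_reindex (f := @rev_ord k) (g := @rev_ord k)) => //;
  try exact: rev_ord_inj; move=> i j; rewrite [RHS]mxE; last first.
  by rewrite mxE (inj_eq rev_ord_inj).
rewrite !Jordan0E; congr (_%:R).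
by case: i j => [i il] [j jl] /=; lia.
Qed.

Lemma Jordan_shift n (a : F) : Jordan n 0 + a%:M = Jordan n a.
Proof.
apply/matrixP=> i j; rewrite mxE Jordan0E !mxE [i == j]eq_sym.
case: (eqVneq j i) => [->|_]; first by rewrite ltn_eqF // add0r.
by rewrite addr0; case: eqP.
Qed.

Lemma injective_no_singular m n (C D : 'M[F]_(m, n)) k :
  (forall v : 'cV_n, D *m v = 0 -> v = 0) -> ~ singular_chain C D k.
Proof.
move=> inj [v [/eqP v0 [Cv0 CvS] Dvk]]; apply: v0.
suff h i j : (j + i = k)%N -> v j = 0 by exact: (h k).
elim: i j => [|i IH] j; first by rewrite addn0 => ->; apply: inj.
move=> jk; apply: inj; rewrite -CvS; last by rewrite -jk addnS !ltnS leq_addr.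
by rewrite IH ?mulmx0 // -jk addnS.
Qed.

Definition has_kronecker m n (A B : 'M[F]_(m, n)) :=
  exists2 t, all (@kblock_ok F) t &
    heqv A B (dsum (@kfst F) t) (dsum (@ksnd F) t).

(** The induction is on [m + n] because [KF 0] has no rows and [KFT 0] no columns: only the sum is
    sure to drop. *)
Lemma has_kronecker_cons m n m2 n2 p q (A B : 'M[F]_(m, n)) b (A2 B2 : 'M_(m2, n2))
    (P Q : 'M_(p, q)) :
  heqv A B (block_mx P 0 0 A2) (block_mx Q 0 0 B2) ->
  heqv P Q (kfst b) (ksnd b) -> kblock_ok b ->
  ((m2 + n2 < m + n)%N -> has_kronecker A2 B2) -> has_kronecker A B.
Proof.
move=> h hb ok IH.
have [t tok ht] : has_kronecker A2 B2.
  apply: IH; have [-> ->] := heqv_dim h; have [-> ->] := heqv_dim hb.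
  by case: b {hb} ok => [k l|k|k|k] /=; lia.
exists (b :: t); first by rewrite /= ok.
exact: heqv_trans h (heqv_block hb ht).
Qed.

Lemma not_row_free m n (A : 'M[F]_(m, n)) :
  ~~ row_free A -> exists2 v : 'cV_m, v != 0 & A^T *m v = 0.
Proof.
rewrite -kermx_eq0 => /rowV0Pn[v /sub_kermxP vA v0]; exists v^T.
  by rewrite trmx_eq0.
by rewrite -trmx_mul vA trmx0.
Qed.

Lemma row_free_cV_inj m n (A : 'M[F]_(m, n)) (v : 'cV_m) :
  row_free A -> A^T *m v = 0 -> v = 0.
Proof.
move=> fA /(congr1 trmx); rewrite trmx_mul trmxK trmx0 => h.
by apply: trmx_inj; apply: (row_free_inj fA); rewrite /= h trmx0 mul0mx.
Qed.

End KroneckerField.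

Theorem kronecker_existence (F : closedFieldType) m n (A B : 'M[F]_(m, n)) :
  has_kronecker A B.
Proof.
have [N] := ubnP (m + n)%N.
elim: N m n A B => // N IH m n A B lt.
have step m2 n2 (A2 B2 : 'M[F]_(m2, n2)) :
    (m2 + n2 < m + n)%N -> has_kronecker A2 B2.
  by move=> h; apply: IH; apply: leq_trans h lt.
have [fAT|/not_row_free[v v0]] := boolP (row_free A^T); last first.
  rewrite trmxK => Av.
  have [[k /split_singular]|] := split_kernel B v0 Av.
    case=> l [m2 [n2 [A2 [B2 h]]]].
    exact: (has_kronecker_cons (b := (KF l)) h (Gmx_Fmx_rev _ _) isT (@step _ _ _ _)).
  case=> k [m2 [n2 [A2 [B2 h]]]].
  exact: (has_kronecker_cons (b := (Kinf k.+1)) h (heqv_refl _ _) isT (@step _ _ _ _)).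
have [fA|/not_row_free[v v0 Av]] := boolP (row_free A); last first.
  have [[k /split_singular]|] := split_kernel B^T v0 Av.
    case=> l [m2 [n2 [A2 [B2 /heqv_tr]]]].
    rewrite !tr_block_mx !trmx0 !trmxK => h.
    apply: (has_kronecker_cons (b := (KFT l)) h _ isT (@step _ _ _ _)).
    exact: heqv_tr (Gmx_Fmx_rev _ _).
  case=> k [m2 [n2 [A2 [B2 /heqv_tr]]]].
  rewrite !tr_block_mx !trmx0 !trmxK trmx1 => h.
  apply: (has_kronecker_cons (b := (Kinf k.+1)) h _ isT (@step _ _ _ _)).
  exact: Jordan0_tr_rev.
have mn : m = n.
  apply/eqP; rewrite eqn_leq -{1}(eqnP fA) rank_leq_col.
  by rewrite -{1}(eqnP fAT) rank_leq_col.
case: n / mn A B fA fAT {lt} step => A B fA fAT step.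
have [m0|m0] := posnP m.
  exists [::] => //=; subst m.
  by rewrite [A]flatmx0 [B]flatmx0; apply: heqv_refl.
have uA : A \in unitmx by rewrite -row_free_unit.
(* [eigenvalue] is about row vectors; the transpose yields a column vector killed by
   [B - a *: A]. *)
pose g := (invmx A *m B)^T.
have /closed_rootP[a] : size (char_poly g) != 1%N.
  by rewrite size_char_poly eqSS -lt0n.
rewrite -eigenvalue_root_char => /eigenvalueP[w wg w0].
have Cw : (B - a *: A) *m w^T = 0.
  move/(congr1 trmx): wg; rewrite trmx_mul trmxK linearZ /= => wg.
  by rewrite mulmxBl -scalemxAl scalemxAr -wg !mulmxA mulmxV // mul1mx subrr.
have wT0 : w^T != 0 by rewrite trmx_eq0.
(* Here [A] is the second matrix of the pencil, and its injectivity rules out singular chains.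
   Adding [a *: A] back turns the split-off nilpotent block into one with eigenvalue [a]. *)
have [[k]|] := split_kernel A wT0 Cw.
  case/injective_no_singular=> v; rewrite -{1}[A]trmxK; exact: row_free_cV_inj.
case=> k [m2 [n2 [C2 [D2 /heqv_swap /(heqv_lin a)]]]].
rewrite subrK scale_block_mx add_block_mx !scaler0 !addr0 scalemx1 Jordan_shift => h.
exact: (has_kronecker_cons (b := (KJ k.+1 a)) h (heqv_refl _ _) isT (@step _ _ _ _)).
Qed.

(** * Invariants of the Kronecker form *)

Section Invariants.
Variable F : fieldType.

(* The space of end points x_(k-1) of row chains
   x_0 C = 0, x_1 C = x_0 D, ..., x_(k-1) C = x_(k-2) D. *)
Fixpoint lchain m n (C D : 'M[F]_(m, n)) k : 'M_m :=
  if k is k'.+1 then kermx (C *m cokermx (lchain C D k' *m D)) else 0.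

Lemma lchain_sub m n p (C D : 'M[F]_(m, n)) k (x : 'M_(p, m)) :
  (x <= lchain C D k.+1)%MS = (x *m C <= lchain C D k *m D)%MS.
Proof. by rewrite sub_kermx mulmxA submxE. Qed.

Lemma eqmx_rV m1 m2 n (A : 'M[F]_(m1, n)) (B : 'M_(m2, n)) :
  (forall x : 'rV_n, (x <= A)%MS = (x <= B)%MS) -> (A :=: B)%MS.
Proof. by move=> h; apply/eqmxP/andP; split; apply/rV_subP => x; rewrite h. Qed.

Lemma sub_mulR p q m m' (R : 'M[F]_(m', m)) R' (x : 'M_(p, m')) (U : 'M_(q, m)) :
  R *m R' = 1%:M -> R' *m R = 1%:M -> (x <= U *m R')%MS = (x *m R <= U)%MS.
Proof.
move=> h h'; apply/idP/idP => [/(submxMr R)|/(submxMr R')].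
  by rewrite -mulmxA h' mulmx1.
by rewrite -mulmxA h mulmx1.
Qed.

Lemma lchain_conj m n m' n' (C D : 'M[F]_(m, n)) R R' S S' k :
  R *m R' = 1%:M -> R' *m R = 1%:M -> S *m S' = 1%:M -> S' *m S = 1%:M ->
  (lchain (R *m C *m S : 'M_(m', n')) (R *m D *m S) k :=: lchain C D k *m R')%MS.
Proof.
move=> h1 h2 h3 h4; elim: k => [|k IH].
  by apply: eqmx_rV => x; rewrite /= mul0mx !eqmx0.
apply: eqmx_rV => x; rewrite (sub_mulR _ _ h1 h2) !lchain_sub.
rewrite (eqmxMr _ IH).
by rewrite !mulmxA -(mulmxA _ R') h2 mulmx1 (sub_mulR _ _ h4 h3) -(mulmxA _ S) h3 mulmx1.
Qed.

Lemma rank_lchain_heqv m n m' n' (C D : 'M[F]_(m, n)) (C' D' : 'M_(m', n')) k :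
  heqv C D C' D' -> \rank (lchain C D k) = \rank (lchain C' D' k).
Proof.
case=> R [R' [S [S' [[h1 h2 h3 h4] [-> ->]]]]].
rewrite (lchain_conj _ _ _ h1 h2 h3 h4) mxrankMfree //.
by apply/row_freeP; exists R.
Qed.

Lemma rank_lchain_cap_heqv m n m' n' (C D : 'M[F]_(m, n)) (C' D' : 'M_(m', n')) k l :
  heqv C D C' D' -> \rank (lchain C D k :&: lchain D C l) =
                    \rank (lchain C' D' k :&: lchain D' C' l).
Proof.
case=> R [R' [S [S' [[h1 h2 h3 h4] [-> ->]]]]].
have -> : \rank (lchain C D k :&: lchain D C l) =
          \rank ((lchain C D k :&: lchain D C l)%MS *m R').
  by rewrite mxrankMfree //; apply/row_freeP; exists R.
apply/eqmx_rank/eqmxP/eqmx_rV => x; rewrite (sub_mulR _ _ h1 h2) !sub_capmx.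
by rewrite !(lchain_conj _ _ _ h1 h2 h3 h4) !(sub_mulR _ _ h1 h2).
Qed.

Lemma sub_diag_block m1 n1 m2 n2 (U : 'M[F]_(m1, n1)) (W : 'M_(m2, n2))
    (x : 'rV_n1) (y : 'rV_n2) :
  (row_mx x y <= block_mx U 0 0 W)%MS = (x <= U)%MS && (y <= W)%MS.
Proof.
apply/submxP/andP => [[z]|[/submxP[a ->] /submxP[b ->]]].
  rewrite -[z]hsubmxK mul_row_block !mulmx0 addr0 add0r => /eq_row_mx[-> ->].
  by rewrite !submxMl.
by exists (row_mx a b); rewrite mul_row_block !mulmx0 addr0 add0r.
Qed.

Lemma lchain_block m1 n1 m2 n2 (C1 D1 : 'M[F]_(m1, n1)) (C2 D2 : 'M_(m2, n2)) k :
  (lchain (block_mx C1 0 0 C2) (block_mx D1 0 0 D2) k :=: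
   block_mx (lchain C1 D1 k) 0 0 (lchain C2 D2 k))%MS.
Proof.
elim: k => [|k IH]; first by rewrite /= block_mx0.
apply: eqmx_rV => x; rewrite lchain_sub (eqmxMr _ IH) -[x]hsubmxK sub_diag_block.
rewrite !lchain_sub mul_row_block mulmx_block.
by rewrite !(mulmx0, mul0mx, addr0, add0r) sub_diag_block.
Qed.

Lemma rank_lchain_block m1 n1 m2 n2 (C1 D1 : 'M[F]_(m1, n1)) (C2 D2 : 'M_(m2, n2)) k :
  \rank (lchain (block_mx C1 0 0 C2) (block_mx D1 0 0 D2) k) =
  (\rank (lchain C1 D1 k) + \rank (lchain C2 D2 k))%N.
Proof. by rewrite lchain_block rank_diag_block_mx. Qed.

Lemma rank_lchain_cap_block m1 n1 m2 n2 (C1 D1 : 'M[F]_(m1, n1))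
    (C2 D2 : 'M_(m2, n2)) k l :
  \rank (lchain (block_mx C1 0 0 C2) (block_mx D1 0 0 D2) k :&:
         lchain (block_mx D1 0 0 D2) (block_mx C1 0 0 C2) l)%MS =
  (\rank (lchain C1 D1 k :&: lchain D1 C1 l)%MS +
   \rank (lchain C2 D2 k :&: lchain D2 C2 l)%MS)%N.
Proof.
rewrite -rank_diag_block_mx; apply/eqmx_rank/eqmxP/eqmx_rV => x.
rewrite sub_capmx !lchain_block -[x]hsubmxK !sub_diag_block !sub_capmx.
by rewrite andbACA.
Qed.

Definition jordan_rank m n (A B : 'M[F]_(m, n)) l k := \rank (lchain (B - l *: A) A k).
Definition infinite_rank m n (A B : 'M[F]_(m, n)) k := \rank (lchain A B k).
(** A row chain for [(B, A)] whose last vector is killed by [A] gives a polynomial left null vector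
    of the pencil; the rank is the number of row minimal indices smaller than [k]. *)
Definition minimal_rank m n (A B : 'M[F]_(m, n)) k :=
  \rank (lchain B A k :&: lchain A B 1)%MS.

Lemma jordan_rank_heqv m n m' n' (A B : 'M[F]_(m, n)) (A' B' : 'M_(m', n')) l k :
  heqv A B A' B' -> jordan_rank A B l k = jordan_rank A' B' l k.
Proof.
by move=> h; apply/rank_lchain_heqv/heqv_swap; rewrite -!scaleNr; apply: heqv_lin.
Qed.

Lemma infinite_rank_heqv m n m' n' (A B : 'M[F]_(m, n)) (A' B' : 'M_(m', n')) k :
  heqv A B A' B' -> infinite_rank A B k = infinite_rank A' B' k.
Proof. exact: rank_lchain_heqv. Qed.

Lemma minimal_rank_heqv m n m' n' (A B : 'M[F]_(m, n)) (A' B' : 'M_(m', n')) k :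
  heqv A B A' B' -> minimal_rank A B k = minimal_rank A' B' k.
Proof. by move/heqv_swap; apply: rank_lchain_cap_heqv. Qed.

Section DsumRank.
Variables (L : Type) (r c : L -> nat) (M N : forall x : L, 'M[F]_(r x, c x)).

Lemma jordan_rank_dsum s l k : jordan_rank (dsum M s) (dsum N s) l k =
  (\sum_(x <- s) jordan_rank (M x) (N x) l k)%N.
Proof.
elim: s => [|x s IH]; first by rewrite big_nil /jordan_rank [lchain _ _ _]flatmx0 mxrank0.
rewrite big_cons -IH /jordan_rank /= -rank_lchain_block.
by rewrite scale_block_mx opp_block_mx add_block_mx !(scaler0, oppr0, addr0).
Qed.

Lemma infinite_rank_dsum s k : infinite_rank (dsum M s) (dsum N s) k =
  (\sum_(x <- s) infinite_rank (M x) (N x) k)%N.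
Proof.
elim: s => [|x s IH]; first by rewrite big_nil /infinite_rank [lchain _ _ _]flatmx0 mxrank0.
by rewrite big_cons -IH -rank_lchain_block.
Qed.

Lemma minimal_rank_dsum s k : minimal_rank (dsum M s) (dsum N s) k =
  (\sum_(x <- s) minimal_rank (M x) (N x) k)%N.
Proof.
elim: s => [|x s IH]; first by rewrite big_nil /minimal_rank [(_ :&: _)%MS]flatmx0 mxrank0.
by rewrite big_cons -IH -rank_lchain_cap_block.
Qed.
End DsumRank.

(** * Chain spaces of the Kronecker blocks *)

Lemma lchain_row_free m n (C D : 'M[F]_(m, n)) k : row_free C -> lchain C D k = 0.
Proof.
move=> fC; elim: k => // k IH; apply/eqP; rewrite -submx0; apply/rV_subP => x.
rewrite lchain_sub IH mul0mx eqmx0 !submx0 => /eqP h; apply/eqP.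
by apply: (row_free_inj fC); rewrite /= h mul0mx.
Qed.

Lemma Jordan_unit n (a : F) : a != 0 -> Jordan n a \in unitmx.
Proof.
move=> a0; rewrite -unitmx_tr unitmxE det_trig.
  by rewrite unitfE; apply/prodf_neq0 => i _; rewrite !mxE eqxx.
apply/is_trig_mxP => i j ij; rewrite !mxE -val_eqE /=.
by case: eqP => [e|_]; [lia | case: eqP => // e; lia].
Qed.

(** Both sides are the space of rows supported on the last [k] coordinates; right multiplication by
    the block shifts coordinates to the right. The truncated [n - k] covers [k] larger than [n]. *)
Lemma lchain_Jordan0 n k :
  (lchain (Jordan n 0) 1%:M k :=: kermx (pid_mx (n - k) : 'M[F]_n))%MS.
Proof.
have P j (x : 'rV_n) : (x <= kermx (pid_mx j : 'M[F]_n))%MS =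
    [forall i : 'I_n, (i < j)%N ==> (x 0 i == 0)].
  rewrite sub_kermx.
  have E i : (x *m (pid_mx j : 'M_n)) 0 i = x 0 i *+ (i < j)%N.
    case: ltnP => ij.
      by apply: mulmx_selr => l; rewrite mxE -val_eqE /=; case: eqP => // ->; rewrite ij.
    by apply: mulmx_zeror => l; rewrite mxE; case: eqP => // ->; rewrite ltnNge ij.
  apply/eqP/forallP => [h i|h].
    apply/implyP=> ij; have := congr1 (fun X : 'rV_n => X 0 i) h.
    by rewrite E ij mxE mulr1n => ->.
  apply/rowP=> i; rewrite E mxE; case: ltnP => // ij.
  by have /implyP/(_ ij)/eqP := h i.
elim: k => [|k IH].
  by rewrite subn0 pid_mx_1; apply/eqmx_sym/eqmxP;
    rewrite sub0mx andbT submx0 kermx_eq0 row_free_unit unitmx1.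
apply: eqmx_rV => x; rewrite lchain_sub mulmx1 IH !P.
apply/forallP/forallP => h i; apply/implyP=> ik.
  have lt : (i.+1 < n)%N by have := ltn_ord i; lia.
  have lt2 : (i.+1 < n - k)%N by lia.
  by have /implyP/(_ lt2) := h (Ordinal lt); rewrite (@mul_Jordan0 _ _ _ _ _ _ i).
case: i ik => [[|i] lt] /= ik; first by rewrite mul_Jordan00.
rewrite (@mul_Jordan0 _ _ _ _ _ _ (Ordinal (ltnW lt))) //.
by have /implyP := h (Ordinal (ltnW lt)); apply => /=; lia.
Qed.

Lemma rank_lchain_Jordan0 n k : \rank (lchain (Jordan n (0 : F)) 1%:M k) = minn k n.
Proof. by rewrite lchain_Jordan0 mxrank_ker rank_pid_mx ?leq_subr //; lia. Qed.

Lemma Fmx_row_free n : row_free (Fmx F n).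
Proof.
apply/row_freeP; exists (Fmx F n)^T; apply/matrixP=> i j.
rewrite (@Fmx_mul _ _ _ _ _ (widen_ord (leqnSn n) i)) // !mxE /=.
by rewrite val_eqE.
Qed.

Lemma Gmx_row_free n : row_free (Gmx F n).
Proof.
apply/row_freeP; exists (Gmx F n)^T; apply/matrixP=> i j.
by rewrite (@Gmx_mul _ _ _ _ _ (lift 0 i)) // !mxE /= eqSS val_eqE.
Qed.

(** For [x] in the left kernel, the last column gives [x_(n-1) = 0] and the other nonzero columns
    give [x_i = l x_(i+1)]. *)
Lemma pencil_row_free n l : row_free (Gmx F n - l *: Fmx F n).
Proof.
rewrite -kermx_eq0; apply/rowV0P => x /sub_kermxP.
rewrite mulmxBr -scalemxAr => /eqP; rewrite subr_eq0 => /eqP h.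
have hc j : (x *m Gmx F n) 0 j = l * (x *m Fmx F n) 0 j by rewrite h mxE.
suff H d (i : 'I_n) : (i + d.+1 = n)%N -> x 0 i = 0.
  by apply/rowP=> i; rewrite mxE; apply: (H (n - i.+1)%N); have := ltn_ord i; lia.
elim: d i => [|d IH] i id.
  have e : @ord_max n = i.+1 :> nat by rewrite addn1 in id.
  by have := hc ord_max; rewrite (mul_Gmx _ _ e) mul_Fmx0 mulr0.
have lt : (i.+1 < n)%N by lia.
have := hc (lift 0 i); rewrite (@mul_Gmx _ _ _ _ _ i) //.
by rewrite (@mul_Fmx _ _ _ _ _ (Ordinal lt)) // (IH (Ordinal lt)) ?mulr0 // -[RHS]id addSnnS.
Qed.

Lemma mul_Fmx_tr m n (X : 'M[F]_(m, n.+1)) i (j : 'I_n) (k : 'I_n.+1) :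
  k = j :> nat -> (X *m (Fmx F n)^T) i j = X i k.
Proof. by move=> kj; apply: mulmx_selr => l; rewrite !mxE -kj. Qed.

Lemma mul_Gmx_tr m n (X : 'M[F]_(m, n.+1)) i (j : 'I_n) (k : 'I_n.+1) :
  k = j.+1 :> nat -> (X *m (Gmx F n)^T) i j = X i k.
Proof. by move=> kj; apply: mulmx_selr => l; rewrite !mxE -kj. Qed.

Lemma lchain_KFT n k (x : 'rV[F]_n.+1) :
  (x <= lchain (Gmx F n)^T (Fmx F n)^T k)%MS =
  [forall i : 'I_n.+1, (k <= i)%N ==> (x 0 i == 0)].
Proof.
elim: k x => [|k IH] x.
  rewrite submx0; apply/eqP/forallP => [-> i|h]; first by rewrite mxE eqxx implybT.
  by apply/rowP=> i; rewrite mxE; apply/eqP: (h i).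
rewrite lchain_sub; apply/idP/forallP => [/submxP[z /esym hz] i|h].
  apply/implyP=> ki; case: (unliftP 0 i) ki => [j ->|-> //]; rewrite lift0 ltnS => kj.
  rewrite -(@mul_Gmx_tr _ _ _ _ j) ?lift0 // -hz mulmxA.
  rewrite (@mul_Fmx_tr _ _ _ _ _ (lift ord_max j)) ?lift_max //.
  have := submxMl z (lchain (Gmx F n)^T (Fmx F n)^T k); rewrite IH.
  by move/forallP/(_ (lift ord_max j)); rewrite lift_max kj.
(* Since F F^T = 1, the row x G^T equals z F^T with z = x G^T F. *)
rewrite -[x *m _]mulmx1.
have -> : 1%:M = Fmx F n *m (Fmx F n)^T.
  apply/matrixP=> i j; rewrite (@mul_Fmx_tr _ _ _ _ _ (lift ord_max j)) ?lift_max //.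
  by rewrite !mxE lift_max eq_sym val_eqE.
rewrite mulmxA submxMr // IH; apply/forallP=> i; apply/implyP=> ki.
case: (unliftP ord_max i) ki => [j ->|->]; last by rewrite mul_Fmx0.
rewrite lift_max (@mul_Fmx _ _ _ _ _ j) ?lift_max // => kj.
rewrite (@mul_Gmx_tr _ _ _ _ _ (lift 0 j)) ?lift0 //.
by have /implyP := h (lift 0 j); rewrite lift0; apply.
Qed.

(** The rows supported on the first [k] coordinates are intersected with the line of the last basis
    vector. *)
Lemma minimal_rank_KFT n k :
  minimal_rank (Fmx F n)^T (Gmx F n)^T k = (n < k)%N.
Proof.
have P (x : 'rV[F]_n.+1) : (x <= lchain (Fmx F n)^T (Gmx F n)^T 1)%MS =
    [forall j : 'I_n, x 0 (lift ord_max j) == 0].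
  rewrite lchain_sub mul0mx eqmx0 submx0; apply/eqP/forallP => [h j|h].
    by rewrite -(@mul_Fmx_tr _ _ _ _ j) ?lift_max // h mxE.
  apply/rowP=> j; rewrite (@mul_Fmx_tr _ _ _ _ _ (lift ord_max j)) ?lift_max // mxE.
  exact/eqP.
rewrite /minimal_rank; case: ltnP => nk.
  rewrite -[RHS](mxrank_delta F (0 : 'I_1) (@ord_max n)).
  apply/eqmx_rank/eqmxP/eqmx_rV => x; rewrite sub_capmx lchain_KFT P.
  have -> : [forall i : 'I_n.+1, (k <= i)%N ==> (x 0 i == 0)].
    by apply/forallP=> i; apply/implyP; have := ltn_ord i; lia.
  apply/forallP/sub_rVP => [h|[a ->] j]; last first.
    by rewrite !mxE eqxx [_ == ord_max]eq_sym (negbTE (neq_lift _ _)) mulr0.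
  exists (x 0 ord_max); apply/rowP=> i; rewrite !mxE eqxx /=.
  case: (unliftP ord_max i) => [j ->|->]; last by rewrite eqxx mulr1.
  by rewrite (eqP (h j)) [_ == ord_max]eq_sym (negbTE (neq_lift _ _)) mulr0.
apply/eqP; rewrite mxrank_eq0 -submx0; apply/rV_subP => x.
rewrite sub_capmx lchain_KFT P submx0 => /andP[/forallP h1 /forallP h2].
apply/eqP/rowP=> i; rewrite mxE; apply/eqP.
by case: (unliftP ord_max i) => [j ->|->] //; apply: (implyP (h1 _)).
Qed.

Lemma jordan_rank_KJ n a l k :
  jordan_rank 1%:M (Jordan n (a : F)) l k = if l == a then minn k n else 0%N.
Proof.
rewrite /jordan_rank scalemx1; have -> : Jordan n a - l%:M = Jordan n (a - l).
  by rewrite -[in LHS](Jordan_shift _ a) -[in RHS]Jordan_shift raddfB addrA.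
case: eqVneq => [->|la]; first by rewrite subrr rank_lchain_Jordan0.
by rewrite lchain_row_free ?mxrank0 // row_free_unit Jordan_unit // subr_eq0 eq_sym.
Qed.

Lemma jordan_rank_Kinf n l k : jordan_rank (Jordan n (0 : F)) 1%:M l k = 0%N.
Proof.
rewrite /jordan_rank lchain_row_free ?mxrank0 // row_free_unit.
rewrite -unitmx_tr unitmxE det_trig.
  rewrite unitfE; apply/prodf_neq0 => i _.
  by rewrite !mxE !eqxx mulr0 subr0 oner_eq0.
apply/is_trig_mxP => i j ij; rewrite !mxE -!val_eqE /=.
case: (eqVneq (i : nat) j) => [e|_]; first lia.
case: (eqVneq (j : nat) i) => [e|_]; first lia.
by case: eqVneq => [e|_]; [lia | rewrite mulr0 subr0].
Qed.

Definition is_KFT (b : kblock F) := if b is KFT _ then true else false.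
Definition is_KF (b : kblock F) := if b is KF _ then true else false.

Lemma minimal_rank_kblock b k : minimal_rank (kfst b) (ksnd b) k =
  if b is KFT n then (n < k)%N else 0%N.
Proof.
have r1 n : row_free (1%:M : 'M[F]_n) by rewrite row_free_unit unitmx1.
case: b => [n a|n|n|n]; rewrite /minimal_rank; [| | |exact: minimal_rank_KFT].
- by rewrite [lchain (kfst _) _ _]lchain_row_free //= capmx0 mxrank0.
- by rewrite [lchain (ksnd _) _ _]lchain_row_free //= cap0mx mxrank0.
- by rewrite [lchain (ksnd _) _ _]lchain_row_free ?Gmx_row_free //= cap0mx mxrank0.
Qed.

(** [KFT] is set apart because G^T - l F^T has more rows than columns, so that row chains exist for
    every [l]. *)
Lemma jordan_rank_kblock b l k : ~~ is_KFT b -> jordan_rank (kfst b) (ksnd b) l k =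
  if b is KJ n a then if l == a then minn k n else 0%N else 0%N.
Proof.
case: b => [n a|n|n|n] //= _; [exact: jordan_rank_KJ | exact: jordan_rank_Kinf |].
by rewrite /jordan_rank lchain_row_free ?mxrank0 ?pencil_row_free.
Qed.

Lemma infinite_rank_kblock b k : ~~ is_KFT b -> infinite_rank (kfst b) (ksnd b) k =
  if b is Kinf n then minn k n else 0%N.
Proof.
rewrite /infinite_rank; case: b => [n a|n|n|n] //= _.
- by rewrite lchain_row_free ?mxrank0 // row_free_unit unitmx1.
- exact: rank_lchain_Jordan0.
- by rewrite lchain_row_free ?mxrank0 ?Fmx_row_free.
Qed.

(** * Multiplicities of blocks from ranks *)

Section Counts.
Variables t t' : seq (kblock F).

Lemma count_mem_sum (x : kblock F) s : count_mem x s = (\sum_(b <- s) (b == x))%N.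
Proof. by rewrite -sum1_count big_mkcond. Qed.

(** Passing from [n] to [n.+1] raises the sum of the minimal ranks by the number of blocks
    [KFT n]. *)
Lemma count_KFT_eq :
  (forall k, (\sum_(b <- t) minimal_rank (kfst b) (ksnd b) k)%N =
             (\sum_(b <- t') minimal_rank (kfst b) (ksnd b) k)%N) ->
  forall n, count_mem (KFT n) t = count_mem (KFT n) t'.
Proof.
move=> h n.
have E s : (count_mem (KFT n) s + \sum_(b <- s) minimal_rank (kfst b) (ksnd b) n)%N =
           (\sum_(b <- s) minimal_rank (kfst b) (ksnd b) n.+1)%N.
  rewrite count_mem_sum -big_split; apply: eq_bigr => b _.
  rewrite /= !minimal_rank_kblock; case: b => //= m.
  have -> : (KFT m == KFT n :> kblock F) = (m == n) by apply/eqP/eqP => [[]|->].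
  by lia.
by have := E t; rewrite (h n) (h n.+1) -E => /addIn.
Qed.

Lemma sum_KFT_eq (f : kblock F -> nat) :
  (forall n, count_mem (KFT n) t = count_mem (KFT n) t') ->
  (\sum_(b <- t) f b)%N = (\sum_(b <- t') f b)%N ->
  (\sum_(b <- t | ~~ is_KFT b) f b)%N = (\sum_(b <- t' | ~~ is_KFT b) f b)%N.
Proof.
move=> h; rewrite (bigID is_KFT) [RHS](bigID is_KFT) /=.
suff -> : (\sum_(b <- t | is_KFT b) f b)%N = (\sum_(b <- t' | is_KFT b) f b)%N by move/addnI.
rewrite -big_filter -[RHS]big_filter; apply: perm_big; apply/allP => b _ /=.
rewrite !count_filter; apply/eqP; case: b => [n a|n|n|n].
4: by have := h n; congr (_ = _); apply: eq_count => b /=; case: eqP => // ->.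
all: by rewrite !(@eq_count _ _ pred0) ?count_pred0 // => -[] //= *; rewrite andbF.
Qed.

Hypotheses (tok : all (@kblock_ok F) t) (tok' : all (@kblock_ok F) t').

(* The second difference of k |-> min k n is supported at k = n. *)
Lemma count_jordan_type (g : nat -> kblock F -> nat) (x : kblock F) n : (0 < n)%N ->
  ~~ is_KFT x ->
  (forall b, kblock_ok b -> ~~ is_KFT b ->
     ((b == x) + g n.-1 b + g n.+1 b = 2 * g n b)%N) ->
  (forall n, count_mem (KFT n) t = count_mem (KFT n) t') ->
  (forall k, (\sum_(b <- t) g k b)%N = (\sum_(b <- t') g k b)%N) ->
  count_mem x t = count_mem x t'.
Proof.
move=> n0 xT hx hT h.
(* The second difference, written without subtraction in [nat] and summed over the blocks other than
   [KFT]. *)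
have E s : all (@kblock_ok F) s -> (count_mem x s + \sum_(b <- s | ~~ is_KFT b) g n.-1 b
    + \sum_(b <- s | ~~ is_KFT b) g n.+1 b)%N = (2 * \sum_(b <- s | ~~ is_KFT b) g n b)%N.
  move=> /allP sok; rewrite big_distrr /= count_mem_sum (bigID is_KFT) /=.
  rewrite big1 ?add0n => [|b]; last by case: eqP => // -> xx; rewrite xx in xT.
  rewrite -big_split -big_split /= [LHS]big_seq_cond [RHS]big_seq_cond.
  apply: eq_bigr => b /andP[bs bT].
  by apply: hx => //; apply: sok.
have := E _ tok; have := E _ tok'.
have HH k := sum_KFT_eq hT (h k); by rewrite !HH => <- /addIn/addIn ->.
Qed.

End Counts.

(** [KF] is excluded because all the row chain spaces of such a block vanish: these ranks do not
    detect it. *)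
Theorem kblock_counts t t' b :
  all (@kblock_ok F) t -> all (@kblock_ok F) t' ->
  (forall k, (\sum_(b <- t) minimal_rank (kfst b) (ksnd b) k)%N =
             (\sum_(b <- t') minimal_rank (kfst b) (ksnd b) k)%N) ->
  (forall l k, (\sum_(b <- t) jordan_rank (kfst b) (ksnd b) l k)%N =
             (\sum_(b <- t') jordan_rank (kfst b) (ksnd b) l k)%N) ->
  (forall k, (\sum_(b <- t) infinite_rank (kfst b) (ksnd b) k)%N =
             (\sum_(b <- t') infinite_rank (kfst b) (ksnd b) k)%N) ->
  ~~ is_KF b -> count_mem b t = count_mem b t'.
Proof.
move=> tok tok' /count_KFT_eq hT hJ hI.
have nok c s : ~~ kblock_ok c -> all (@kblock_ok F) s -> count_mem c s = 0%N.
  by move=> cok /allP sok; apply/count_memPn; apply: contra cok => /sok.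
case: b => [p a|p|//|p _]; last exact: hT.
- have [p0 _|p0 _] := ltnP 0 p; last by rewrite !nok //= -leqNgt.
  apply: (@count_jordan_type _ _ tok tok' (fun k b => jordan_rank (kfst b) (ksnd b) a k)
    _ p p0 _ _ hT (hJ a)) => // b bok bT.
  rewrite !jordan_rank_kblock //; case: b bok bT => //= q c q0 _.
  have -> : (KJ q c == KJ p a) = (q == p) && (a == c).
    by apply/eqP/andP => [[-> ->]|[/eqP-> /eqP->]].
  by case: (a == c); rewrite ?andbT ?andbF; lia.
have [p0 _|p0 _] := ltnP 0 p; last by rewrite !nok //= -leqNgt.
apply: (@count_jordan_type _ _ tok tok' (fun k b => infinite_rank (kfst b) (ksnd b) k)
  _ p p0 _ _ hT hI) => // b bok bT.
rewrite !infinite_rank_kblock //; case: b bok bT => //= q q0 _.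
have -> : (Kinf q == Kinf p :> kblock F) = (q == p) by apply/eqP/eqP => [[]|->].
lia.
Qed.

End Invariants.

(** * Equivalent symmetric pairs are congruent *)

Section Congruence.
Variable F : closedFieldType.
Hypothesis charF : 2%N \notin [pchar F].

Lemma two_neq0 : 2%:R != 0 :> F.
Proof. by move: charF; rewrite inE. Qed.

Lemma sqr_shift (R : comNzRingType) (p q h c x : R) :
  p ^+ 2 - x = h * q -> (p + c * q) ^+ 2 - x = (h + 2%:R * c * p + c ^+ 2 * q) * q.
Proof.
move=> hq; have -> : (p + c * q) ^+ 2 - x =
  (p ^+ 2 - x) + (2%:R * c * p + c ^+ 2 * q) * q by ring.
by rewrite hq; ring.
Qed.

(** A Newton correction, one root at a time: if [p ^+ 2 - 'X = h * q], then adding [c *: q] to [p]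
    keeps divisibility by [q], and [c] is chosen to make the new cofactor vanish at [a]. Repeated
    roots need no special treatment. *)
Lemma sqrtX_mod (rs : seq F) : 0 \notin rs ->
  exists p : {poly F}, \prod_(z <- rs) ('X - z%:P) %| p ^+ 2 - 'X.
Proof.
elim: rs => [|a rs IH]; first by exists 0; rewrite big_nil dvd1p.
rewrite inE negb_or eq_sym => /andP[a0 /IH[p]]; set q := \prod_(z <- rs) _.
move=> /dvdpP[h hq].
pose P := h.[a]%:P + (2%:R * p.[a]) *: 'X + q.[a] *: 'X^2.
(* [P] is the new cofactor at [a] as a polynomial in [c]. If it were a nonzero constant, then
   [q.[a]] and [p.[a]] would vanish, and [hq] at [a] would give [a = 0]. *)
have /closed_rootP[c] : size P != 1%N.
  apply/negP=> /eqP sP.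
  have c2 : P`_2 = 0 by rewrite nth_default ?sP.
  have c1 : P`_1 = 0 by rewrite nth_default ?sP.
  move: c2 c1; rewrite /P !coefD !coefZ !coefC !coefX !coefXn /=.
  rewrite !(mulr0, mulr1, add0r, addr0) => qa /eqP.
  rewrite mulf_eq0 (negbTE two_neq0) /= => /eqP pa.
  move/(congr1 (horner^~ a)): hq; rewrite !hornerE qa pa expr0n mulr0 sub0r /=.
  by move/eqP; rewrite oppr_eq0 (negbTE a0).
move=> Pc; exists (p + c%:P * q); rewrite (sqr_shift _ hq).
rewrite big_cons dvdp_mul // dvdp_XsubCl rootE !hornerE; apply/eqP.
move: Pc; rewrite rootE /P !(hornerD, hornerZ, hornerC, hornerX, hornerXn) => /eqP <-.
by ring.
Qed.

(** Zero is not an eigenvalue of [M], so ['X] is a square modulo the characteristic polynomial;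
    Cayley-Hamilton transfers this to [M]. *)
Lemma sqrt_horner_mx n (M : 'M[F]_n.+1) : M \in unitmx ->
  exists p : {poly F}, horner_mx M p *m horner_mx M p = M.
Proof.
move=> uM; have [rs rsE] := closed_field_poly_normal (char_poly M).
rewrite (monicP (char_poly_monic M)) scale1r in rsE.
have rs0 : 0 \notin rs.
  rewrite -root_prod_XsubC -rsE -eigenvalue_root_char.
  apply/negP=> /eigenvalueP[v vM v0]; case/eqP: v0.
  by rewrite -(mulmxK uM v) vM scale0r mul0mx.
have [p pX] := sqrtX_mod rs0; exists p.
have : horner_mx M (p ^+ 2 - 'X) = 0.
  move: pX; rewrite -rsE => /dvdpP[h ->].
  by rewrite rmorphM /= Cayley_Hamilton mulr0.
rewrite rmorphB rmorphXn /= horner_mx_X => /eqP; rewrite subr_eq0 => /eqP.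
by rewrite expr2.
Qed.

Lemma horner_mx_selfadjoint n (M A : 'M[F]_n.+1) p :
  M *m A = A *m M^T -> horner_mx M p *m A = A *m (horner_mx M p)^T.
Proof.
move=> MA; elim/poly_ind: p => [|p c IH].
  by rewrite rmorph0 trmx0 mul0mx mulmx0.
rewrite mulrC rmorphD rmorphM /= horner_mx_X horner_mx_C mulmxDl.
have -> : (M * horner_mx M p + c%:M)^T = (horner_mx M p)^T *m M^T + c%:M.
  by apply/matrixP=> i j; rewrite -trmx_mul !mxE eq_sym.
have e : horner_mx M p *m A *m M^T = horner_mx M p *m M *m A.
  by rewrite -mulmxA -MA mulmxA.
have eC : M * horner_mx M p = horner_mx M p *m M.
  by rewrite -{1 4}[M]horner_mx_X -[RHS]/(_ * _) -!rmorphM mulrC.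
by rewrite mulmxDr mulmxA -IH e eC scalar_mxC.
Qed.

(* If R A S is symmetric, so is S^-T (R A S) S^-1 = M A with M = S^-T R.  A
   polynomial square root X of M then also satisfies X A = A X^T, and so
   M A = X X A = X A X^T. *)
Lemma heqv_congruent n (A B A' B' : 'M[F]_n) :
  A^T = A -> B^T = B -> A'^T = A' -> B'^T = B' ->
  heqv A B A' B' -> congruent A B A' B'.
Proof.
case: n A B A' B' => [|n] A B A' B' sA sB sA' sB'.
  move=> _; exists 1%:M; rewrite ?unitmx1 // !trmx1 !mulmx1 !mul1mx.
  by rewrite [A]flatmx0 [B]flatmx0 [A']flatmx0 [B']flatmx0.
case=> R [R' [S [S' [[RR' R'R SS' S'S] [A'E B'E]]]]].
pose M := S'^T *m R.
have uM : M \in unitmx.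
  rewrite unitmx_mul unitmx_tr; have [-> _] := mulmx1_unit RR'.
  by have [_ ->] := mulmx1_unit SS'.
have ME (Y Y' : 'M_n.+1) : Y' = R *m Y *m S -> M *m Y = S'^T *m Y' *m S'.
  by move=> ->; rewrite !mulmxA -(mulmxA _ S) SS' mulmx1.
have Msym (Y Y' : 'M_n.+1) : Y^T = Y -> Y'^T = Y' -> Y' = R *m Y *m S ->
    M *m Y = Y *m M^T.
  move=> sY sY' YE; rewrite -{2}sY -trmx_mul (ME _ _ YE) !trmx_mul trmxK sY'.
  by rewrite mulmxA.
have [p pM] := sqrt_horner_mx uM; set X := horner_mx M p in pM.
exists (X^T *m S).
  rewrite unitmx_mul unitmx_tr; have [-> _] := mulmx1_unit SS'.
  by move: uM; rewrite -pM unitmx_mul => /andP[->].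
have main (Y Y' : 'M_n.+1) : Y^T = Y -> Y'^T = Y' -> Y' = R *m Y *m S ->
   (X^T *m S)^T *m Y *m (X^T *m S) = Y'.
  move=> sY sY' YE; have XY := horner_mx_selfadjoint p (Msym _ _ sY sY' YE).
  rewrite trmx_mul trmxK -!mulmxA (mulmxA Y) -XY !mulmxA -(mulmxA _ X X) pM.
  rewrite -(mulmxA _ M) (ME _ _ YE) !mulmxA -trmx_mul S'S trmx1 mul1mx.
  by rewrite -mulmxA S'S mulmx1.
by split; apply: main.
Qed.

End Congruence.

(** * Kronecker forms of the tridiagonal pairs *)

(* The bipartite double of the path 0 - 1 - ... - n-1 with a loop at 0 is a path
   with 2 n vertices, numbered from 0 to 2 n - 1; [fold_path n] sends it back to
   the original path. Its odd vertices are the row copies and its even vertices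
   the column copies of 0, ..., n-1. *)
Definition fold_path (n z : nat) : nat := if (z < n)%N then (n - z.+1)%N else (z - n)%N.

Section CanonicalBlocks.
Variable F : fieldType.

Lemma fold_path_row_lt n (i : 'I_n) : (fold_path n (2 * i).+1 < n)%N.
Proof. by rewrite /fold_path; have := ltn_ord i; case: ifP; lia. Qed.

Lemma fold_path_col_lt n (i : 'I_n) : (fold_path n (2 * i) < n)%N.
Proof. by rewrite /fold_path; have := ltn_ord i; case: ifP; lia. Qed.

Definition path_row n (i : 'I_n) := Ordinal (fold_path_row_lt i).
Definition path_col n (i : 'I_n) := Ordinal (fold_path_col_lt i).

Lemma path_row_inj n : injective (@path_row n).
Proof.
move=> i j /(congr1 val); rewrite /= /fold_path => h; apply: ord_inj.
by move: h; have := ltn_ord i; have := ltn_ord j; do 2 case: ifP; lia.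
Qed.

Lemma path_col_inj n : injective (@path_col n).
Proof.
move=> i j /(congr1 val); rewrite /= /fold_path => h; apply: ord_inj.
by move: h; have := ltn_ord i; have := ltn_ord j; do 2 case: ifP; lia.
Qed.

(* The loop of weight q at 0 fits the alternation of the weights p, q along the
   unfolded path. *)
Lemma tridiag_unfold n (p q : F) (i j : 'I_n) :
  tridiag n (diag1 q) (alt p q) (path_row i) (path_col j) =
  if j == i then alt p q n else if j == i.+1 :> nat then alt p q n.+1 else 0.
Proof.
have [il jl] := (ltn_ord i, ltn_ord j).
rewrite mxE -!val_eqE /= /diag1 /alt /fold_path.
have par x y : odd x = odd y ->
  (if odd x then q else p) = (if odd y then q else p) by move->.
have loop x : odd x -> (if odd x then q else p) = q by move->.
case: (ltnP (2 * i).+1 n) => h1; case: (ltnP (2 * j) n) => h2;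
  do 6? [case: eqP => ?; try by [exfalso; lia]].
all: by [|apply: par; lia | rewrite loop //; lia | apply/esym/loop; lia].
Qed.

Definition bidiag n (a b : F) : 'M_n :=
  \matrix_(i < n, j < n) (if j == i then a else if j == i.+1 :> nat then b else 0).

Lemma bidiag1 n : bidiag n 1 0 = 1%:M.
Proof.
by apply/matrixP=> i j; rewrite !mxE eq_sym; case: eqP => // _; case: eqP.
Qed.

(** The unfolding does not depend on the weights, so one reindexing makes both matrices bidiagonal.
    The parity of [n] decides which weight lands on the diagonal, hence which matrix of a canonical
    pair becomes the identity. *)
Lemma tridiag_bidiag n (p q p' q' : F) :
  heqv (tridiag n (diag1 q) (alt p q)) (tridiag n (diag1 q') (alt p' q'))
    (bidiag n (alt p q n) (alt p q n.+1)) (bidiag n (alt p' q' n) (alt p' q' n.+1)).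
Proof.
apply: (heqv_reindex (@path_row_inj n) (@path_col_inj n)) => // i j;
  by rewrite mxE tridiag_unfold.
Qed.

Lemma fst_iE n : fst_i F n = tridiag n (diag1 0) (alt 1 0).
Proof.
by apply/matrixP=> i j; rewrite !mxE /diag1; case: (nat_of_ord i == 0)%N.
Qed.

Lemma type_i_even n (l : F) : ~~ odd n ->
  heqv (fst_i F n) (snd_i n l true) 1%:M (Jordan n l).
Proof.
move=> /negbTE no; have := tridiag_bidiag n 1 0 l 1.
by rewrite fst_iE /snd_i /alt /= no bidiag1.
Qed.

Lemma type_i_odd n : odd n ->
  heqv (fst_i F n) (snd_i n 0 true) (Jordan n 0) 1%:M.
Proof.
move=> no; have := tridiag_bidiag n 1 0 0 1.
by rewrite fst_iE /snd_i /alt /= no bidiag1.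
Qed.

Lemma type_ii_odd n (l : F) : odd n ->
  heqv (fst_ii F n) (snd_ii n l) 1%:M (Jordan n l).
Proof.
move=> no; have := tridiag_bidiag n 0 1 1 l.
by rewrite /fst_ii /snd_ii /alt /= no bidiag1.
Qed.

Lemma type_ii_even n : ~~ odd n ->
  heqv (fst_ii F n) (snd_ii n 0) (Jordan n 0) 1%:M.
Proof.
move=> /negbTE no; have := tridiag_bidiag n 0 1 1 0.
by rewrite /fst_ii /snd_ii /alt /= no bidiag1.
Qed.

(* Row and column orders that put the odd vertices of the path 0 - ... - 2 k
   before, respectively after, the even ones. *)
Lemma type_i_singular k :
  heqv (fst_i F (2 * k + 1)) (snd_i (2 * k + 1) 0 false)
    (block_mx (Fmx F k) 0 0 (Fmx F k)^T) (block_mx (Gmx F k) 0 0 (Gmx F k)^T).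
Proof.
pose fr i := if (i < k)%N then (2 * i).+1 else (2 * (i - k))%N.
pose fc j := if (j < k.+1)%N then (2 * j)%N else (2 * (j - k.+1)).+1.
have rlt (i : 'I_(k + k.+1)) : (fr i < 2 * k + 1)%N.
  by have := ltn_ord i; rewrite /fr; case: ifP; lia.
have clt (j : 'I_(k.+1 + k)) : (fc j < 2 * k + 1)%N.
  by have := ltn_ord j; rewrite /fc; case: ifP; lia.
apply: (heqv_reindex (f := fun i => Ordinal (rlt i)) (g := fun j => Ordinal (clt j))).
- move=> i j /(congr1 val); rewrite /= /fr => h; apply: ord_inj; move: h.
  by have := ltn_ord i; have := ltn_ord j; do 2 case: ifP; lia.
- move=> i j /(congr1 val); rewrite /= /fc => h; apply: ord_inj; move: h.
  by have := ltn_ord i; have := ltn_ord j; do 2 case: ifP; lia.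
- lia.
- lia.
all: move=> i j; rewrite [RHS]mxE -!val_eqE /= /fr /fc /diag1 /alt.
all: case: (split_ordP i) => i' ->; case: (split_ordP j) => j' ->.
all: rewrite ?(block_mxEul, block_mxEur, block_mxEdl, block_mxEdr) !mxE /=.
all: have := ltn_ord i'; have := ltn_ord j'.
all: do ?[case: ifP => ?]; try by [exfalso; lia].
all: by [|move=> ? ?; case: eqP => // ?; exfalso; lia].
Qed.

End CanonicalBlocks.

(** * Tridiagonal forms *)

Section Forms.
Variable F : fieldType.

Lemma equivalent_heqv m n (A B A' B' : 'M[F]_(m, n)) :
  equivalent A B A' B' <-> heqv A B A' B'.
Proof.
split=> [[R [S [uR uS <- <-]]]|[R [R' [S [S' [[h1 h2 h3 h4] [-> ->]]]]]]].
  by exists R, (invmx R), S, (invmx S); rewrite !mulmxV ?mulVmx.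
by exists R, S; split=> //; [case: (mulmx1_unit h1) | case: (mulmx1_unit h3)].
Qed.

Lemma is_kronecker_formP m n (A B : 'M[F]_(m, n)) t :
  is_kronecker_form A B t <->
  all (@kblock_ok F) t /\ heqv A B (dsum (@kfst F) t) (dsum (@ksnd F) t).
Proof.
split=> [[tok [er [ec /equivalent_heqv h]]]|[tok h]]; split=> //.
  exact/(heqv_trans h)/heqv_sym/heqv_cast.
have [em en] := heqv_dim h; exists (esym em), (esym en).
exact/equivalent_heqv/(heqv_trans h)/heqv_cast.
Qed.

Lemma tridiag_tr n (d u : nat -> F) : (tridiag n d u)^T = tridiag n d u.
Proof.
apply/matrixP=> i j; rewrite !mxE eq_sym; case: eqVneq => [->//|_].
by case: eqP => [h|_]; case: eqP => [h'|_] //; lia.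
Qed.

Lemma sfst_tr b : (sfst b)^T = sfst b :> 'M[F]__.
Proof. by case: b => *; apply: tridiag_tr. Qed.

Lemma ssnd_tr b : (ssnd b)^T = ssnd b :> 'M[F]__.
Proof. by case: b => *; apply: tridiag_tr. Qed.

Lemma dsum_tr (L : Type) (d : L -> nat) (M : forall x, 'M[F]_(d x, d x)) s :
  (forall x, (M x)^T = M x) -> (dsum M s)^T = dsum M s.
Proof.
by move=> h; elim: s => [|x s IH] /=; rewrite ?trmx0 // tr_block_mx IH h !trmx0.
Qed.

Lemma is_tridiagonal_form_heqv n (A B : 'M[F]_n) s :
  is_tridiagonal_form A B s -> heqv A B (dsum (@sfst F) s) (dsum (@ssnd F) s).
Proof.
case=> _ [e [S uS [hA hB]]]; apply: heqv_trans (heqv_sym (heqv_cast _ _ e e)).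
by apply/equivalent_heqv; exists S^T, S; rewrite unitmx_tr.
Qed.

Definition kronecker_blocks (b : sblock F) : seq (kblock F) :=
  match b with
  | Ti n l eps => if odd n then if eps then [:: Kinf n] else [:: KF n./2; KFT n./2]
                  else [:: KJ n l]
  | Tii n l => if odd n then [:: KJ n l] else [:: Kinf n]
  end.

Lemma sblock_kronecker b : sblock_ok b ->
  heqv (sfst b) (ssnd b) (dsum (@kfst F) (kronecker_blocks b))
       (dsum (@ksnd F) (kronecker_blocks b)).
Proof.
case: b => [n l eps|n l] /=; case: ifP => /= [no|/negbT no]; rewrite ?no ?(negbTE no) /=.
- case/andP=> _ /eqP ->; case: eps => /=.
    exact: (heqv_trans (type_i_odd _ no) (heqv_sym (heqv_block0 _ _))).
  move=> {l}; have -> : n = (2 * n./2 + 1)%N by lia.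
  rewrite (_ : (2 * n./2 + 1)./2 = n./2); last lia.
  apply: (heqv_trans (type_i_singular F _)).
  exact/(heqv_block (heqv_refl _ _))/heqv_sym/heqv_block0.
- case/and3P=> _ -> _ /=.
  exact: (heqv_trans (type_i_even _ no) (heqv_sym (heqv_block0 _ _))).
- move=> _; exact: (heqv_trans (type_ii_odd _ no) (heqv_sym (heqv_block0 _ _))).
- case/andP=> _ /eqP ->.
  exact: (heqv_trans (type_ii_even _ no) (heqv_sym (heqv_block0 _ _))).
Qed.

Lemma dsum_sblock_kronecker s : all (@sblock_ok F) s ->
  heqv (dsum (@sfst F) s) (dsum (@ssnd F) s)
    (dsum (@kfst F) (flatten (map kronecker_blocks s)))
    (dsum (@ksnd F) (flatten (map kronecker_blocks s))).
Proof.
elim: s => [|b s IH] /=; first by move=> _; apply: heqv_refl.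
case/andP=> /sblock_kronecker hb /IH hs.
exact: (heqv_trans (heqv_block hb hs) (heqv_sym (dsum_cat _ _ _ _))).
Qed.

Lemma kronecker_blocks_ok s : all (@sblock_ok F) s ->
  all (@kblock_ok F) (flatten (map kronecker_blocks s)).
Proof.
elim: s => //= b s IH /andP[ok /IH h]; rewrite all_cat {}h andbT.
case: b ok => [n l eps|n l] /=; case: ifP => _; rewrite ?andbT.
- by case: eps => //= /andP[->].
- by case/andP=> /= ->.
- by move=> /= ->.
- by case/andP=> /= ->.
Qed.

(* Since KF and KFT blocks come in pairs, one label per summand is enough. *)
Definition main_block (b : sblock F) : kblock F :=
  match b with
  | Ti n l eps => if odd n then if eps then Kinf n else KFT n./2 else KJ n l
  | Tii n l => if odd n then KJ n l else Kinf n
  end.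

Definition sblock_of (b : kblock F) : sblock F :=
  match b with
  | KJ n l => if odd n then Tii n l else Ti n l true
  | Kinf n => if odd n then Ti n 0 true else Tii n 0
  | KF n | KFT n => Ti (2 * n).+1 0 false
  end.

Lemma main_blockK b : sblock_ok b -> sblock_of (main_block b) = b.
Proof.
case: b => [n l eps|n l] /=; case: ifP => /= no; rewrite ?no /=.
- case/andP=> _ /eqP ->; case: eps => /=; rewrite ?no //.
  by congr Ti; lia.
- by case/and3P=> _ ->.
- by [].
- by case/andP=> _ /eqP ->.
Qed.

Lemma sblock_ofK b : ~~ is_KF b -> main_block (sblock_of b) = b.
Proof.
case: b => [n l|n|//|n] _ /=; rewrite ?mul2n /= ?odd_double /=;
  try by case: ifP => /= no; rewrite no.
by congr KFT; lia.
Qed.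

Lemma sblock_of_ok b : kblock_ok b -> sblock_ok (sblock_of b).
Proof.
by case: b => [n l|n|n|n] //=; try (case: ifP => //= no ->; rewrite no ?eqxx //=);
  rewrite ?mul2n /= ?odd_double /= ?eqxx.
Qed.

Lemma count_kronecker_blocks c s : ~~ is_KF c ->
  count_mem c (flatten (map kronecker_blocks s)) = count_mem c (map main_block s).
Proof.
move=> cF; elim: s => //= b s IH; rewrite count_cat IH; congr (_ + _)%N.
case: b => [n l []|n l] /=; case: ifP => _ //=; rewrite ?addn0 //.
by rewrite (_ : (KF _ == c) = false) //; case: c cF {IH} => // *; case: eqP.
Qed.

Lemma count_KF_kronecker_blocks k s :
  count_mem (KF k) (flatten (map kronecker_blocks s)) =
  count_mem (KFT k) (map main_block s).
Proof.
elim: s => //= b s IH; rewrite count_cat IH; congr (_ + _)%N.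
case: b => [n l []|n l] /=; case: ifP => _ //=.
by rewrite !addn0; congr (nat_of_bool _); apply/eqP/eqP => [[->]|[->]].
Qed.

Lemma kblock_sums_heqv m n (A B : 'M[F]_(m, n)) t :
  heqv A B (dsum (@kfst F) t) (dsum (@ksnd F) t) ->
  [/\ forall k, (\sum_(b <- t) minimal_rank (kfst b) (ksnd b) k)%N = minimal_rank A B k,
      forall l k, (\sum_(b <- t) jordan_rank (kfst b) (ksnd b) l k)%N = jordan_rank A B l k &
      forall k, (\sum_(b <- t) infinite_rank (kfst b) (ksnd b) k)%N = infinite_rank A B k].
Proof.
move=> h; split=> *.
- by rewrite (minimal_rank_heqv _ h) minimal_rank_dsum.
- by rewrite (jordan_rank_heqv _ _ h) jordan_rank_dsum.
- by rewrite (infinite_rank_heqv _ h) infinite_rank_dsum.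
Qed.

Lemma is_tridiagonal_form_kronecker n (A B : 'M[F]_n) s :
  is_tridiagonal_form A B s ->
  is_kronecker_form A B (flatten (map kronecker_blocks s)).
Proof.
move=> h; have [sok _] := h; apply/is_kronecker_formP; split.
  exact: kronecker_blocks_ok.
exact: (heqv_trans (is_tridiagonal_form_heqv h) (dsum_sblock_kronecker sok)).
Qed.

(** [t1] and [t1'] serve as a link: being permutations of each other, they give the two pairs the
    same rank invariants, which then determine the counts in [t2] and [t2']. *)
Lemma kronecker_form_counts m n m' n' (A B : 'M[F]_(m, n)) (A' B' : 'M_(m', n'))
    t1 t2 t1' t2' b :
  is_kronecker_form A B t1 -> is_kronecker_form A' B' t1' -> perm_eq t1 t1' ->
  is_kronecker_form A B t2 -> is_kronecker_form A' B' t2' ->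
  ~~ is_KF b -> count_mem b t2 = count_mem b t2'.
Proof.
move=> /is_kronecker_formP[_ /kblock_sums_heqv[m1 j1 i1]].
move=> /is_kronecker_formP[_ /kblock_sums_heqv[m1' j1' i1']] tt'.
move=> /is_kronecker_formP[ok2 /kblock_sums_heqv[m2 j2 i2]].
move=> /is_kronecker_formP[ok2' /kblock_sums_heqv[m2' j2' i2']].
apply: kblock_counts => // *.
- by rewrite m2 m2' -m1 -m1'; apply: perm_big.
- by rewrite j2 j2' -j1 -j1'; apply: perm_big.
- by rewrite i2 i2' -i1 -i1'; apply: perm_big.
Qed.

(** [main_block] is injective on admissible labels and never takes a value [KF], so the counts
    visible to row chains determine the list of labels. *)
Lemma tridiagonal_form_determined n n' (A B : 'M[F]_n) (A' B' : 'M[F]_n') t t' s s' :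
  is_kronecker_form A B t -> is_kronecker_form A' B' t' -> perm_eq t t' ->
  is_tridiagonal_form A B s -> is_tridiagonal_form A' B' s' -> perm_eq s s'.
Proof.
move=> kt kt' tt' hs hs'; have [sok _] := hs; have [sok' _] := hs'.
have ks := is_tridiagonal_form_kronecker hs.
have ks' := is_tridiagonal_form_kronecker hs'.
suff : perm_eq (map main_block s) (map main_block s').
  move/(perm_map sblock_of); rewrite -!map_comp.
  have E r : all (@sblock_ok F) r -> map (sblock_of \o main_block) r = r.
    by move/allP=> ok; apply: map_id_in => b /ok /main_blockK.
  by rewrite !E.
apply/allP => b _ /=; apply/eqP.
have [bF|bF] := boolP (is_KF b); last first.
  by rewrite -!count_kronecker_blocks //; apply: kronecker_form_counts kt kt' tt' ks ks' bF.
have Z r : count_mem b (map main_block r) = 0%N.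
  apply/count_memPn/mapP=> -[[x l eps|x l] _ e]; move: bF; rewrite e /=; case: ifP => //.
  by case: eps {e}.
by rewrite !Z.
Qed.

Definition tr_kblock (b : kblock F) : kblock F :=
  match b with KF n => KFT n | KFT n => KF n | _ => b end.

Lemma kblock_tr b :
  heqv (kfst b)^T (ksnd b)^T (kfst (tr_kblock b)) (ksnd (tr_kblock b)).
Proof.
case: b => [n l|n|n|n] /=; rewrite ?trmxK ?trmx1; last 2 first.
- exact: heqv_refl.
- exact: heqv_refl.
- have /heqv_swap/(heqv_lin l) := @Jordan0_tr_rev F n.
  by rewrite !scalemx1 Jordan_shift -{1}(tr_scalar_mx _ l) -raddfD /= Jordan_shift.
- exact: Jordan0_tr_rev.
Qed.

Lemma dsum_kblock_tr t :
  heqv (dsum (@kfst F) t)^T (dsum (@ksnd F) t)^T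
    (dsum (@kfst F) (map tr_kblock t)) (dsum (@ksnd F) (map tr_kblock t)).
Proof.
elim: t => [|b t IH] /=; first by rewrite trmx0; apply: heqv_refl.
by rewrite !tr_block_mx !trmx0; apply: heqv_block (kblock_tr b) IH.
Qed.

Lemma symmetric_count_KF n (A B : 'M[F]_n) t k : A^T = A -> B^T = B ->
  is_kronecker_form A B t -> count_mem (KF k) t = count_mem (KFT k) t.
Proof.
move=> sA sB kt; have /is_kronecker_formP[tok h] := kt.
have kt' : is_kronecker_form A B (map tr_kblock t).
  apply/is_kronecker_formP; split.
    by rewrite all_map; apply: sub_all tok => -[].
  by have := heqv_trans (heqv_tr h) (dsum_kblock_tr t); rewrite sA sB.
(* [t] and its transposed list are forms of the same pair, and a [KFT k] of the latter comes from a
   [KF k] of [t]. *)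
rewrite (@kronecker_form_counts _ _ _ _ _ _ _ _ _ _ _ _ (KFT k) kt kt (perm_refl t)
  kt kt') //.
rewrite count_map; apply: eq_count => b /=.
by case: b => [p a|p|p|p] /=; apply/eqP/eqP => // -[->].
Qed.

End Forms.

Lemma tridiagonal_existence (F : closedFieldType) (charF : 2%N \notin [pchar F])
    n (A B : 'M[F]_n) : A^T = A -> B^T = B ->
  exists s : seq (sblock F), is_tridiagonal_form A B s.
Proof.
move=> sA sB; have [t tok h] := kronecker_existence A B.
have kt : is_kronecker_form A B t by apply/is_kronecker_formP.
(* Each [KFT] block gives one singular summand, which brings its own [KF] block along; hence the
   [KF] blocks of [t] are dropped here. *)
pose s := map (@sblock_of F) [seq b <- t | ~~ is_KF b].
have sok : all (@sblock_ok F) s.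
  rewrite all_map; apply/allP => b; rewrite mem_filter => /andP[_ bt].
  by apply: sblock_of_ok; apply: (allP tok).
have main_s : map (@main_block F) s = [seq b <- t | ~~ is_KF b].
  rewrite -map_comp; apply: map_id_in => b; rewrite mem_filter => /andP[bF _].
  exact: sblock_ofK.
have ts : perm_eq t (flatten (map (@kronecker_blocks F) s)).
  have E b : ~~ is_KF b -> count_mem b (map (@main_block F) s) = count_mem b t.
    move=> bF; rewrite main_s count_filter; apply: eq_count => c /=.
    by case: eqP => // ->; rewrite bF.
  apply/allP => b _ /=; apply/eqP.
  have [|bF] := boolP (is_KF b); last by rewrite count_kronecker_blocks // E.
  case: b => // k _; rewrite count_KF_kronecker_blocks E //.
  exact: symmetric_count_KF kt.
have hs : heqv A B (dsum (@sfst F) s) (dsum (@ssnd F) s).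
  apply: (heqv_trans h); apply: (heqv_trans (dsum_perm _ _ ts)).
  exact/heqv_sym/dsum_sblock_kronecker.
exists s; split=> //; have [e _] := heqv_dim hs; exists (esym e).
have tr_cast m (e' : m = n) (X : 'M[F]_m) : X^T = X ->
    (castmx (e', e') X)^T = castmx (e', e') X.
  by case: n / e' {A B sA sB h kt hs e} => ?; rewrite castmx_id.
apply: (heqv_congruent charF) => //; try apply: tr_cast.
- exact/dsum_tr/sfst_tr.
- exact/dsum_tr/ssnd_tr.
exact/(heqv_trans hs)/heqv_cast.
Qed.

Theorem theorem3p1 (F : closedFieldType) (charF : 2%N \notin [pchar F]) :
  (forall (n : nat) (A B : 'M[F]_n), A^T = A -> B^T = B ->
     exists2 s : seq (sblock F), is_tridiagonal_form A B s &
       forall s' : seq (sblock F), is_tridiagonal_form A B s' -> perm_eq s s')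
  /\
  (forall (n n' : nat) (A B : 'M[F]_n) (A' B' : 'M[F]_n')
      (t t' : seq (kblock F)) (s s' : seq (sblock F)),
     A^T = A -> B^T = B -> A'^T = A' -> B'^T = B' ->
     is_kronecker_form A B t -> is_kronecker_form A' B' t' -> perm_eq t t' ->
     is_tridiagonal_form A B s -> is_tridiagonal_form A' B' s' ->
     perm_eq s s')
  /\
  [/\ forall k : nat,
        is_kronecker_form (fst_i F (2 * k + 1)) (snd_i (2 * k + 1) (0 : F) false)
          [:: KF k; KFT k],
      forall n : nat, odd n ->
        is_kronecker_form (fst_i F n) (snd_i n (0 : F) true) [:: Kinf n],
      forall (n : nat) (lambda : F), (0 < n)%N -> ~~ odd n ->
        is_kronecker_form (fst_i F n) (snd_i n lambda true) [:: KJ n lambda],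
      forall (n : nat) (lambda : F), odd n ->
        is_kronecker_form (fst_ii F n) (snd_ii n lambda) [:: KJ n lambda] &
      forall n : nat, (0 < n)%N -> ~~ odd n ->
        is_kronecker_form (fst_ii F n) (snd_ii n (0 : F)) [:: Kinf n]].
Proof.
split; [|split].
- move=> n A B sA sB; have [s hs] := tridiagonal_existence charF sA sB.
  have ks := is_tridiagonal_form_kronecker hs; exists s => // s' hs'.
  exact: (tridiagonal_form_determined ks ks (perm_refl _) hs hs').
- move=> n n' A B A' B' t t' s s' _ _ _ _; exact: tridiagonal_form_determined.
split=> [k|n no|n l n0 no|n l no|n n0 no]; apply/is_kronecker_formP; split=> //=.
- apply: (heqv_trans (type_i_singular F k)).
  exact/(heqv_block (heqv_refl _ _))/heqv_sym/heqv_block0.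
- by rewrite andbT odd_gt0.
- exact/(heqv_trans (type_i_odd _ no))/heqv_sym/heqv_block0.
- by rewrite n0.
- exact/(heqv_trans (type_i_even _ no))/heqv_sym/heqv_block0.
- by rewrite andbT odd_gt0.
- exact/(heqv_trans (type_ii_odd _ no))/heqv_sym/heqv_block0.
- by rewrite n0.
- exact/(heqv_trans (type_ii_even _ no))/heqv_sym/heqv_block0.
Qed.
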